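(* Let $T_0$ be the operator in $L^2(0,1)$ given by $$\mathcal{D}(T_0)=\{g\in L^2(0,1)\mid g\in AC[0,1],\ g'\in L^2(0,1),\ g(0)=g(1)=0\},\qquad T_0g=g',$$ whose adjoint is given by $\mathcal{D}(T_0^* )=\{g\in L^2(0,1)\mid g\in AC[0,1],\ g'\in L^2(0,1)\}$, $T_0^*g=-g'$. Let $$A=\begin{pmatrix} 0 & T_0^* \\ T_0 & 0 \end{pmatrix}$$ acting in $(L^2(0,1))^2$, and let $$H=\begin{pmatrix} A & A+1 \\ 0 & -A \end{pmatrix}$$ be the resulting Hamiltonian operator matrix on $(L^2(0,1))^4=(L^2(0,1))^2\times(L^2(0,1))^2$. Then: (1) $H$ is symplectic self-adjoint; (2) $\sigma(H)=\sigma_p(H)=\{k\pi : k\in\mathbb{Z}\}$, and it consists of eigenvalues of finite algebraic multiplicity.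
   Context: $L^2(0,1)$ is the complex Hilbert space of square-integrable functions, $AC[0,1]$ is the set of absolutely continuous functions on $[0,1]$, $\mathcal{D}(T)$ is the domain of $T$, $\sigma(T)$ its spectrum and $\sigma_p(T)$ its point spectrum (set of eigenvalues). Block operator matrix: for operators $A,B,C,D$ in a Hilbert space $X$, the matrix $H=\begin{pmatrix} A & B \\ C & D \end{pmatrix}$ denotes the operator on $X\times X$ with domain $\mathcal{D}(H)=(\mathcal{D}(A)\cap\mathcal{D}(C))\times(\mathcal{D}(B)\cap\mathcal{D}(D))$ and action $H(x_1,x_2)^t=(Ax_1+Bx_2,\;Cx_1+Dx_2)^t$. In particular the operator $A$ of the claim has domain $\mathcal{D}(T_0)\times\mathcal{D}(T_0^* )$, and $H$ has domain $\mathcal{D}(A)\times\mathcal{D}(A)$. Hamiltonian operator matrix: a block operator matrix $H=\begin{pmatrix} A & B \\ C & -A^* \end{pmatrix}$ on $X\times X$, $X$ a complex Hilbert space, where $A,B,C$ are closed densely defined operators in $X$, $B$ and $C$ are self-adjoint, and $H$ is densely defined. Let $J=\begin{pmatrix} 0 & I \\ -I & 0 \end{pmatrix}$ on $X\times X$ (here $X=(L^2(0,1))^2$). A Hamiltonian operator matrix $H$ is called symplectic self-adjoint if $JH=(JH)^*$. *)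

(* Defs.v *)
From HB Require Import structures.
From mathcomp Require Import all_boot all_order all_algebra.
From mathcomp Require Import all_classical all_reals all_analysis.
From mathcomp Require Import measurable_realfun.
From mathcomp Require Import complex ring_quotient ring lra.

Set Implicit Arguments.
Unset Strict Implicit.
Unset Printing Implicit Defensive.

Import Order.TTheory GRing.Theory Num.Theory.
Import numFieldNormedType.Exports.

Local Open Scope classical_set_scope.
Local Open Scope ring_scope.
Local Open Scope complex_scope.
Local Open Scope quotient_scope.

(* Complex inner product spaces; the form is linear in its first argument. *)

HB.mixin Record Lmodule_isInnerProduct (R : realType) V
    of GRing.Lmodule R[i] V := {
  inner : V -> V -> R[i] ;
  inner_linearl : forall (z : V) (a : R[i]) (x y : V),
    inner (a *: x + y) z = a * inner x z + inner y z ;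
  inner_conjc : forall x y : V, inner x y = conjc (inner y x) ;
  inner_ge0 : forall x : V, 0 <= inner x x ;
  inner_eq0 : forall x : V, inner x x = 0 -> x = 0 }.

#[short(type="innerProductType")]
HB.structure Definition InnerProduct (R : realType) :=
  {V of GRing.Lmodule R[i] V & Lmodule_isInnerProduct R V}.

Section ProductSpace.
Context (R : realType) (V W : innerProductType R).

Definition inner_pair (x y : V * W) : R[i] :=
  inner x.1 y.1 + inner x.2 y.2.

Let inner_pair_linearl z (a : R[i]) x y :
  inner_pair (a *: x + y) z = a * inner_pair x z + inner_pair y z.
Proof. by rewrite /inner_pair /= !inner_linearl mulrDr addrACA. Qed.

Let inner_pair_conjc x y : inner_pair x y = conjc (inner_pair y x).
Proof.
rewrite /inner_pair (inner_conjc x.1) (inner_conjc x.2).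
case: (inner y.1 x.1) => a b; case: (inner y.2 x.2) => c d.
by apply/eqP; rewrite eq_complex /= opprD !eqxx.
Qed.

Let inner_pair_ge0 x : 0 <= inner_pair x x.
Proof. by rewrite addr_ge0 ?inner_ge0. Qed.

Let inner_pair_eq0 x : inner_pair x x = 0 -> x = 0.
Proof.
move/eqP; rewrite paddr_eq0 ?inner_ge0// => /andP[/eqP x1 /eqP x2].
by case: x x1 x2 => x1 x2 /= /inner_eq0-> /inner_eq0->.
Qed.

HB.instance Definition _ := Lmodule_isInnerProduct.Build R (V * W)%type
  inner_pair_linearl inner_pair_conjc inner_pair_ge0 inner_pair_eq0.

End ProductSpace.

Section Operators.
Context (R : realType) (V : innerProductType R).

Definition hnorm (x : V) : R := Num.sqrt (complex.Re (inner x x)).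

Definition hcvg (u : nat -> V) (x : V) : Prop :=
  (fun n => hnorm (u n - x)) @ \oo --> (0 : R).

(* An operator in V is given by its graph:  T x y  means that x lies in the
   domain of T and T x = y.  Equality of graphs is then equality of domains
   and actions. *)
Definition operator := V -> V -> Prop.

Implicit Types S T : operator.

Definition is_operator T : Prop :=
  [/\ T 0 0,
      forall (a : R[i]) x y x' y', T x y -> T x' y' ->
        T (a *: x + x') (a *: y + y')
    & forall x y y', T x y -> T x y' -> y = y'].

Definition dom T : set V := [set x | exists y, T x y].

Definition densely_defined T : Prop :=
  forall (x : V) (e : R), 0 < e -> exists2 y, dom T y & hnorm (x - y) < e.

Definition closed_operator T : Prop :=
  forall (u v : nat -> V) (x y : V), (forall n, T (u n) (v n)) ->
    hcvg u x -> hcvg v y -> T x y.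

Definition op_scalar (c : R[i]) : operator := fun x y => y = c *: x.

Definition op_add S T : operator :=
  fun x y => exists a b, [/\ S x a, T x b & y = a + b].

Definition op_opp T : operator := fun x y => T x (- y).

Definition op_comp S T : operator := fun x z => exists2 y, T x y & S y z.

Definition op_pow T n : operator := iter n (op_comp T) (op_scalar 1).

(* For densely defined T this is the graph of the Hilbert space adjoint. *)
Definition adjoint T : operator :=
  fun y z => forall x w, T x w -> inner w y = inner x z.

Definition self_adjoint T : Prop := densely_defined T /\ T = adjoint T.

Definition shift T (lam : R[i]) : operator := op_add T (op_scalar (- lam)).

Definition resolvent_set T : set R[i] :=
  [set lam | (forall y, exists! x, shift T lam x y) /\
     exists M : R, forall x y, shift T lam x y -> hnorm x <= M * hnorm y].

Definition spectrum T : set R[i] := ~` resolvent_set T.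

Definition point_spectrum T : set R[i] :=
  [set lam | exists2 x, x <> 0 & T x (lam *: x)].

Definition root_subspace T (lam : R[i]) : set V :=
  [set x | exists n, op_pow (shift T lam) n x 0].

Definition finite_dimensional (E : set V) : Prop :=
  exists (n : nat) (v : 'I_n -> V), forall x, E x ->
    exists c : 'I_n -> R[i], x = \sum_(i < n) c i *: v i.

(* The algebraic multiplicity of an eigenvalue is the dimension of its root
   subspace. *)
Definition finite_algebraic_multiplicity T (lam : R[i]) : Prop :=
  finite_dimensional (root_subspace T lam).

End Operators.

Section BlockOperators.
Context (R : realType) (V : innerProductType R).

Definition block_op (A B C D : operator V) : operator (V * V)%type :=
  fun x y => exists a b c d,
    [/\ A x.1 a, B x.2 b, C x.1 c, D x.2 d & y = (a + b, c + d)].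

Definition hamiltonian (A B C D : operator V) : Prop :=
  [/\ [/\ is_operator A, closed_operator A & densely_defined A],
      [/\ is_operator B, closed_operator B & self_adjoint B],
      [/\ is_operator C, closed_operator C & self_adjoint C],
      D = op_opp (adjoint A)
    & densely_defined (block_op A B C D)].

Definition op_J : operator (V * V)%type :=
  block_op (op_scalar 0) (op_scalar 1) (op_scalar (-1)) (op_scalar 0).

Definition symplectic_self_adjoint (A B C D : operator V) : Prop :=
  hamiltonian A B C D /\
  let JH := op_comp op_J (block_op A B C D) in JH = adjoint JH.

End BlockOperators.

Section L2space.
Context (R : realType).

Local Notation mu := (@lebesgue_measure R).
Local Notation I01 := (`]0%R, 1%R[%classic : set R).

Definition normc2 (z : R[i]) : R := complex.Re z ^+ 2 + complex.Im z ^+ 2.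

Definition sqintegrable (f : R -> R[i]) : Prop :=
  [/\ measurable_fun I01 (fun x => complex.Re (f x)),
      measurable_fun I01 (fun x => complex.Im (f x))
    & mu.-integrable I01 (fun x => (normc2 (f x))%:E)].

Definition sqint_pred : {pred R -> R[i]} := [pred f | `[< sqintegrable f >]].

Let mI01 : measurable I01. Proof. exact: measurable_itv. Qed.

Lemma sqintegrable_submod : submod_closed sqint_pred.
Proof.
split.
  apply/asboolP; split => //=.
  rewrite [X in _.-integrable _ X](_ : _ = cst 0%E); first exact: integrable0.
  by apply/funext => x; rewrite /normc2 !(expr0n, addr0)/= ?expr0n ?addr0.
move=> a f g /asboolP[fr fi f2] /asboolP[gr gi g2]; apply/asboolP.
have E x : (a *: f + g) x = a * f x + g x by [].
have mr : measurable_fun I01 (fun x => complex.Re ((a *: f + g) x)).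
  have -> : (fun x => complex.Re ((a *: f + g) x)) =
     (fun x => complex.Re a * complex.Re (f x) - complex.Im a * complex.Im (f x)
        + complex.Re (g x)).
    by apply/funext => x; rewrite E {E}; case: a (f x) (g x) => [? ?] [? ?] [? ?].
  apply: measurable_funD => //; apply: measurable_funB;
    by apply: measurable_funM => //; exact: measurable_cst.
have mi : measurable_fun I01 (fun x => complex.Im ((a *: f + g) x)).
  have -> : (fun x => complex.Im ((a *: f + g) x)) =
     (fun x => complex.Re a * complex.Im (f x) + complex.Im a * complex.Re (f x)
        + complex.Im (g x)).
    by apply/funext => x; rewrite E {E mr}; case: a (f x) (g x) => [? ?] [? ?] [? ?].
  apply: measurable_funD => //; apply: measurable_funD;
    by apply: measurable_funM => //; exact: measurable_cst.
split => //.
have ifg : mu.-integrable I01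
    (fun x => ((2 * normc2 a)%:E * (normc2 (f x))%:E +
               2%:E * (normc2 (g x))%:E)%E).
  by apply: integrableD => //; exact: integrableZl.
apply: le_integrable ifg => //.
  apply/measurable_EFinP; apply: measurable_funD;
    exact: (measurableT_comp (exprn_measurable 2)).
move=> x _; rewrite -!EFinM -EFinD lee_fin E {E} /normc2 /=.
case: a (f x) (g x) {mr mi} => [a1 a2] [u1 u2] [v1 v2] /=.
rewrite ger0_norm ?addr_ge0 ?sqr_ge0// ger0_norm; last first.
  by rewrite addr_ge0 ?mulr_ge0 ?addr_ge0 ?sqr_ge0.
rewrite -subr_ge0 [leRHS](_ : _ = (a1 * u1 - a2 * u2 - v1) ^+ 2 +
  (a1 * u2 + a2 * u1 - v2) ^+ 2); last by ring.
by rewrite addr_ge0 ?sqr_ge0.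
Qed.

HB.instance Definition _ :=
  GRing.isSubmodClosed.Build R[i] (R -> R[i]) sqint_pred sqintegrable_submod.

(* Square-integrable functions; their values off (0,1) are irrelevant. *)
Record L2fun := MkL2fun { L2fun_val :> R -> R[i] ;
                          _ : L2fun_val \in sqint_pred }.

HB.instance Definition _ := [isSub for L2fun_val].
HB.instance Definition _ := [Choice of L2fun by <:].
HB.instance Definition _ := [SubChoice_isSubLmodule of L2fun by <:].

Let aeF : Filter (nbhs (almost_everywhere mu)).
Proof. exact: (ae_filter_ringOfSetsType mu). Qed.

Definition null_pred : {pred L2fun} :=
  [pred f : L2fun | `[< {ae mu, forall x, I01 x -> f x = 0} >]].

Lemma null_zmod_closed : zmod_closed null_pred.
Proof.
split; first by apply/asboolP; apply: aeW.
move=> f g /asboolP f0 /asboolP g0; apply/asboolP.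
move: f0 g0; apply: (@filterS2 _ _ aeF) => x f0 g0 Ix.
by rewrite /= [LHS](_ : _ = f x - g x)// f0// g0// subrr.
Qed.

HB.instance Definition _ :=
  GRing.isZmodClosed.Build L2fun null_pred null_zmod_closed.

Definition L2 := Quotient.quot null_pred.

Definition L2class (f : L2fun) : L2 := \pi_L2 f.

Lemma L2classP (f g : L2fun) :
  L2class f = L2class g <-> {ae mu, forall x, I01 x -> f x = g x}.
Proof.
rewrite /L2class; split.
  move/eqP; rewrite -Quotient.idealrBE => /asboolP.
  apply: (@filterS _ _ aeF) => x /[apply].
  by rewrite [LHS](_ : _ = f x - g x)// => /eqP; rewrite subr_eq0 => /eqP.
move=> fg; apply/eqP; rewrite -Quotient.idealrBE; apply/asboolP.
move: fg; apply: (@filterS _ _ aeF) => x /[apply] fg.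
by rewrite [LHS](_ : _ = f x - g x)// fg subrr.
Qed.

Lemma reprL2K (x : L2) : L2class (repr x) = x.
Proof. exact: reprK. Qed.

Lemma repr_L2class (f : L2fun) :
  {ae mu, forall x, I01 x -> repr (L2class f) x = f x}.
Proof. by apply/L2classP; rewrite reprL2K. Qed.

Lemma L2classD (f g : L2fun) : L2class (f + g) = L2class f + L2class g.
Proof. exact: raddfD. Qed.

Definition L2scale (a : R[i]) (x : L2) : L2 := L2class (a *: repr x).

Let L2scaleE a f : L2scale a (L2class f) = L2class (a *: f).
Proof.
apply/L2classP; have := repr_L2class f; apply: (@filterS _ _ aeF) => x /[apply] fE.
by rewrite [LHS](_ : _ = a * repr (L2class f) x)// fE.
Qed.

Let L2scaleA a b x : L2scale a (L2scale b x) = L2scale (a * b) x.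
Proof. by rewrite -(reprL2K x) !L2scaleE scalerA. Qed.

Let L2scale1 : left_id 1 L2scale.
Proof. by move=> x; rewrite -(reprL2K x) L2scaleE scale1r. Qed.

Let L2scaleDr : right_distributive L2scale +%R.
Proof.
move=> a x y; rewrite -(reprL2K x) -(reprL2K y).
by rewrite !L2scaleE -!L2classD L2scaleE scalerDr.
Qed.

Let L2scaleDl x : {morph L2scale^~ x : a b / a + b}.
Proof.
by move=> a b; rewrite -(reprL2K x) !L2scaleE -L2classD scalerDl.
Qed.

HB.instance Definition _ := GRing.Zmodule.on L2.
HB.instance Definition _ := GRing.Zmodule_isLmodule.Build R[i] L2
  L2scaleA L2scale1 L2scaleDr L2scaleDl.

Lemma L2classZ a (f : L2fun) : L2class (a *: f) = a *: L2class f.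
Proof. by rewrite -L2scaleE. Qed.

Definition cintegral (f : R -> R[i]) : R[i] :=
  (\int[mu]_(x in I01) complex.Re (f x)) +i*
  (\int[mu]_(x in I01) complex.Im (f x)).

Definition L2inner (x y : L2) : R[i] :=
  cintegral (fun t => (repr x : R -> R[i]) t * conjc ((repr y : R -> R[i]) t)).

Lemma L2funP (f : L2fun) : sqintegrable f.
Proof. by case: f => f /= /asboolP. Qed.

Lemma integrable_mul_conjc (f g : L2fun) :
  mu.-integrable I01 (EFin \o (fun x => complex.Re (f x * conjc (g x)))) /\
  mu.-integrable I01 (EFin \o (fun x => complex.Im (f x * conjc (g x)))).
Proof.
have [fr fi f2] := L2funP f; have [gr gi g2] := L2funP g.
have ifg : mu.-integrable I01
  (fun x => ((normc2 (f x))%:E + (normc2 (g x))%:E)%E) by exact: integrableD.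
split; apply: le_integrable ifg => //.
- rewrite (_ : EFin \o _ = EFin \o (fun x =>
    complex.Re (f x) * complex.Re (g x) + complex.Im (f x) * complex.Im (g x))).
    apply/measurable_EFinP; apply: measurable_funD; exact: measurable_funM.
  apply/funext => x /=; case: (f x) (g x) => [a b] [c d] /=.
  by rewrite mulrN opprK.
- move=> x _; rewrite -!EFinD lee_fin /normc2 /=.
  case: (f x) (g x) => [a b] [c d] /=.
  rewrite [leRHS]ger0_norm; last by rewrite !addr_ge0 ?sqr_ge0.
  have := (sqr_ge0 (a + c), sqr_ge0 (b + d), sqr_ge0 (a - c), sqr_ge0 (b - d)) => -[[[? ?] ?] ?].
  by rewrite ler_norml; apply/andP; split; nra.
- rewrite (_ : EFin \o _ = EFin \o (fun x =>
    complex.Im (f x) * complex.Re (g x) - complex.Re (f x) * complex.Im (g x))).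
    apply/measurable_EFinP; apply: measurable_funB; exact: measurable_funM.
  apply/funext => x /=; case: (f x) (g x) => [a b] [c d] /=.
  by rewrite mulrN addrC.
- move=> x _; rewrite -!EFinD lee_fin /normc2 /=.
  case: (f x) (g x) => [a b] [c d] /=.
  rewrite [leRHS]ger0_norm; last by rewrite !addr_ge0 ?sqr_ge0.
  have := (sqr_ge0 (a + d), sqr_ge0 (b + c), sqr_ge0 (a - d), sqr_ge0 (b - c)) => -[[[? ?] ?] ?].
  by rewrite ler_norml; apply/andP; split; nra.
Qed.

Lemma ae_eq_Rintegral (f g : R -> R) :
  measurable_fun I01 f -> measurable_fun I01 g ->
  {ae mu, forall x, I01 x -> f x = g x} ->
  \int[mu]_(x in I01) f x = \int[mu]_(x in I01) g x.
Proof.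
move=> mf mg fg; congr fine; apply: ae_eq_integral => //.
- exact/measurable_EFinP.
- exact/measurable_EFinP.
- by move: fg; apply: (@filterS _ _ aeF) => x /[apply] ->.
Qed.

Lemma L2innerE (f g : L2fun) :
  L2inner (L2class f) (L2class g) = cintegral (fun t => f t * conjc (g t)).
Proof.
have [/measurable_int/measurable_EFinP r1 /measurable_int/measurable_EFinP i1]
  := integrable_mul_conjc (repr (L2class f)) (repr (L2class g)).
have [/measurable_int/measurable_EFinP r2 /measurable_int/measurable_EFinP i2]
  := integrable_mul_conjc f g.
have fg := @filterI _ _ aeF _ _ (repr_L2class f) (repr_L2class g).
congr (_ +i* _); apply: ae_eq_Rintegral => //.
  by move: fg; apply: (@filterS _ _ aeF) => x [+ +] Ix => /(_ Ix) -> /(_ Ix) ->.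
by move: fg; apply: (@filterS _ _ aeF) => x [+ +] Ix => /(_ Ix) -> /(_ Ix) ->.
Qed.

Let intZ k (f : R -> R) : mu.-integrable I01 (EFin \o f) ->
  mu.-integrable I01 (EFin \o (fun x => k * f x)).
Proof.
move=> fi; have := @integrableZl _ _ _ mu I01 _ k _ fi.
by apply.
Qed.

Let intD (f g : R -> R) : mu.-integrable I01 (EFin \o f) ->
  mu.-integrable I01 (EFin \o g) ->
  mu.-integrable I01 (EFin \o (fun x => f x + g x)).
Proof.
move=> fi gi; have := @integrableD _ _ _ mu I01 _ _ _ fi gi.
by apply.
Qed.

Let intB (f g : R -> R) : mu.-integrable I01 (EFin \o f) ->
  mu.-integrable I01 (EFin \o g) ->
  mu.-integrable I01 (EFin \o (fun x => f x - g x)).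
Proof.
move=> fi gi; have := @integrableB _ _ _ mu I01 _ _ _ fi gi.
by apply.
Qed.

Let L2inner_linearl z (a : R[i]) x y :
  L2inner (a *: x + y) z = a * L2inner x z + L2inner y z.
Proof.
rewrite -(reprL2K x) -(reprL2K y) -(reprL2K z) -L2classZ -L2classD !L2innerE.
move: (repr x) (repr y) (repr z) => f g h.
have [r1 i1] := integrable_mul_conjc f h.
have [r2 i2] := integrable_mul_conjc g h.
case: a => a b; apply/eqP; rewrite eq_complex; apply/andP; split; apply/eqP.
- rewrite /= -!RintegralZl// -RintegralB//; last 2 first.
  + exact: (intZ a r1).
  + exact: (intZ b i1).
  rewrite -RintegralD//; last first.
    exact: (intB (intZ a r1) (intZ b i1)).
  apply: eq_Rintegral => t _.
  rewrite [X in X * _](_ : _ = (a +i* b) * f t + g t)//.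
  by case: (f t) (g t) (h t) => [? ?] [? ?] [? ?] /=; ring.
- rewrite /= -!RintegralZl// -RintegralD//; last 2 first.
  + exact: (intZ a i1).
  + exact: (intZ b r1).
  rewrite -RintegralD//; last first.
    exact: (intD (intZ a i1) (intZ b r1)).
  apply: eq_Rintegral => t _.
  rewrite [X in X * _](_ : _ = (a +i* b) * f t + g t)//.
  by case: (f t) (g t) (h t) => [? ?] [? ?] [? ?] /=; ring.
Qed.

Let L2inner_conjc x y : L2inner x y = conjc (L2inner y x).
Proof.
rewrite -(reprL2K x) -(reprL2K y) !L2innerE.
move: (repr x) (repr y) => f g.
have [r1 i1] := integrable_mul_conjc g f.
apply/eqP; rewrite eq_complex; apply/andP; split; apply/eqP => /=.
  apply: eq_Rintegral => t _.
  by case: (f t) (g t) => [? ?] [? ?] /=; ring.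
rewrite -mulN1r -RintegralZl//.
apply: eq_Rintegral => t _.
by case: (f t) (g t) => [? ?] [? ?] /=; ring.
Qed.

Let L2inner_sqr (f : L2fun) :
  L2inner (L2class f) (L2class f) = (\int[mu]_(x in I01) normc2 (f x))%:C.
Proof.
rewrite L2innerE; apply/eqP; rewrite eq_complex; apply/andP; split; apply/eqP => /=.
  apply: eq_Rintegral => t _.
  by rewrite /normc2; case: (f t) => [? ?] /=; ring.
rewrite -[RHS](mul0r (\int[mu]_(x in I01) (0 : R))) -RintegralZl//; last first.
  exact: integrable0.
by apply: eq_Rintegral => t _; case: (f t) => [? ?] /=; ring.
Qed.

Let normc2_ge0 z : 0 <= normc2 z.
Proof. by rewrite addr_ge0 ?sqr_ge0. Qed.

Let L2inner_ge0 x : 0 <= L2inner x x.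
Proof.
by rewrite -(reprL2K x) L2inner_sqr ler0c; apply: Rintegral_ge0.
Qed.

Let L2inner_eq0 x : L2inner x x = 0 -> x = 0.
Proof.
rewrite -(reprL2K x) L2inner_sqr => -[I0].
have [_ _ f2] := L2funP (repr x).
rewrite [RHS](_ : 0 = L2class 0); last by rewrite [RHS]raddf0.
apply/L2classP.
have /(ae_eq_integral_abs mu mI01 (measurable_int _ f2)) :
    (\int[mu]_(t in I01) `|(normc2 (repr x t))%:E| = 0)%E.
  transitivity ((\int[mu]_(t in I01) normc2 (repr x t))%:E).
    rewrite fineK; last exact: integrable_fin_num.
    by apply: eq_integral => t _; rewrite gee0_abs// lee_fin.
  by rewrite I0.
apply: (@filterS _ _ aeF) => t /[apply] -[/eqP].
rewrite paddr_eq0 ?sqr_ge0// !sqrf_eq0 => /andP[/eqP re0 /eqP im0].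
by rewrite [RHS](_ : _ = 0)//; apply/eqP; rewrite eq_complex re0 im0 !eqxx.
Qed.

HB.instance Definition _ := Lmodule_isInnerProduct.Build R L2
  L2inner_linearl L2inner_conjc L2inner_ge0 L2inner_eq0.

End L2space.

Section Example.
Context (R : realType).

Local Notation mu := (@lebesgue_measure R).

Definition absolutely_continuous (a b : R) (f : R -> R[i]) : Prop :=
  forall e : R, 0 < e -> exists2 d : R, 0 < d &
    forall s : seq (R * R),
      (forall p, p \in s -> [&& a <= p.1, p.1 <= p.2 & p.2 <= b]) ->
      pairwise (fun p q => (p.2 <= q.1) || (q.2 <= p.1)) s ->
      \sum_(p <- s) (p.2 - p.1) < d ->
      \sum_(p <- s) Normc.normc (f p.2 - f p.1) < e.

Definition is_cderive (f : R -> R[i]) (x : R) (l : R[i]) : Prop :=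
  is_derive x (1 : R) (fun t => complex.Re (f t)) (complex.Re l) /\
  is_derive x (1 : R) (fun t => complex.Im (f t)) (complex.Im l).

(* f is an absolutely continuous representative of the class g, and the class
   h is its almost everywhere derivative. *)
Definition ac_derivative (f : L2fun R) (g h : L2 R) : Prop :=
  [/\ g = L2class f, absolutely_continuous 0 1 f
    & exists2 k : L2fun R, h = L2class k &
        {ae mu, forall x : R, 0 < x < 1 -> is_cderive f x (k x)}].

Definition T0 : operator (L2 R) := fun g h =>
  exists f : L2fun R, [/\ ac_derivative f g h, f 0 = 0 & f 1 = 0].

Definition T0_star : operator (L2 R) := fun g h =>
  exists f : L2fun R, ac_derivative f g (- h).

Definition opA : operator (L2 R * L2 R)%type :=
  block_op (op_scalar 0) (adjoint T0) T0 (op_scalar 0).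

End Example.

Arguments T0 R _ _ : clear implicits.
Arguments T0_star R _ _ : clear implicits.
Arguments opA R _ _ : clear implicits.

(* Main.v *)
Require Import Defs.
From mathcomp Require Import all_boot all_order all_algebra.
From mathcomp Require Import all_classical all_reals all_analysis.
From mathcomp Require Import measurable_realfun.
From mathcomp Require Import complex.
From mathcomp Require Import ring lra.

Set Implicit Arguments.
Unset Strict Implicit.
Unset Printing Implicit Defensive.

Import Order.TTheory GRing.Theory Num.Theory.
Import numFieldNormedType.Exports.

(** The operator [A] is self-adjoint, and everything about [H] follows from that
    and from explicit knowledge of the resolvent and the eigenvectors of [A].

    Differentiation. The basic fact is that an absolutely continuous function with
    almost everywhere vanishing derivative is constant ([AC_derive0_cst]). As
    square-integrable functions have absolutely continuous primitives
    ([exists_primitive]), it yields the fundamental theorem of calculus and, applied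
    to products, integration by parts in L^2 ([integration_by_parts_L2]). Hence the
    adjoint of [T0] is minus differentiation without boundary conditions
    ([adjoint_T0]), and the adjoint of that operator is [T0] again
    ([adjoint_T0_star]), because the boundary terms force the values at 0 and 1 to
    vanish. The domain of [T0] is dense: truncate, approximate by continuous
    functions, then smooth and cut off near the end points ([densely_defined_T0]).
    Being off-diagonal with mutually adjoint entries, [A] is self-adjoint
    ([self_adjoint_opA]).

    The symplectic structure. [J H] has the rows [(0, - A)] and [(- A, - A - 1)].
    Pairing an element of the graph of its adjoint with vectors [(x, 0)] and [(0, x)]
    determines the two components one after the other
    ([symplectic_self_adjoint_block]).

    The spectrum of [A]. The equation [(A - lam) (f, g) = (r, s)] is the system
    [- g' - lam f = r], [f' - lam g = s] with [f] vanishing at 0 and 1. In terms of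
    [p = g + i f] and [q = g - i f] it decouples into [p' = i lam p + (i s - r)] and
    [q' = - i lam q - (r + i s)], with [p = q] at 0 and at 1. The condition at 0 leaves
    one free constant, which the condition at 1 determines exactly if
    [exp (i lam) <> exp (- i lam)], that is if [lam] is not a multiple of [pi]
    ([resolvent_set_opA]). Otherwise the solutions of the homogeneous problem are the
    multiples of [(sin (lam t), cos (lam t))] ([opA_eigenvector], [eigenvectorAP]).

    The spectrum of [H]. As [H] is triangular with diagonal [A], [- A], its resolvent
    set contains every [lam] for which [lam] and [- lam] are in the resolvent set of [A]
    ([resolvent_set_block_hamiltonian]), and the eigenvalues of [A] are eigenvalues of
    [H]. The set of multiples of [pi] being symmetric, this determines the spectrum.
    A self-adjoint operator has no Jordan blocks, so the root subspace of [H] at a real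
    [lam] lies in [(N(A - lam) + N(A + lam)) x N(A + lam)]
    ([root_subspace_block_hamiltonian]), which has dimension at most 3. *)

Local Open Scope classical_set_scope.
Local Open Scope ring_scope.
Local Open Scope complex_scope.

Local Notation normc := (@Normc.normc _).
Local Notation Re := complex.Re.
Local Notation Im := complex.Im.

(** * The modulus of complex numbers *)

Section ComplexNumbers.
Context {R : realType}.
Implicit Types z w : R[i].

Lemma normc_sqr z : normc z ^+ 2 = Re z ^+ 2 + Im z ^+ 2.
Proof. by case: z => a b; rewrite sqr_sqrtr// addr_ge0 ?sqr_ge0. Qed.

Lemma normc_ge0 z : 0 <= normc z.
Proof. by case: z => a b; exact: sqrtr_ge0. Qed.

Lemma normc_real (x : R) : normc x%:C = `|x|.
Proof. by rewrite /= expr0n addr0 sqrtr_sqr. Qed.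

Lemma normc_conj z : normc (conjc z) = normc z.
Proof. by case: z => a b /=; rewrite sqrrN. Qed.

Lemma mulcJ z : z * conjc z = (normc z ^+ 2)%:C.
Proof. by case: z => a b; rewrite normc_sqr /=; simpc; congr (_ +i* _); ring. Qed.

Lemma le_Re_normc z : `|Re z| <= normc z.
Proof.
rewrite -(@ler_pXn2r _ 2)// ?nnegrE ?normc_ge0// normc_sqr real_normK ?num_real//.
by rewrite lerDl sqr_ge0.
Qed.

Lemma le_Im_normc z : `|Im z| <= normc z.
Proof.
rewrite -(@ler_pXn2r _ 2)// ?nnegrE ?normc_ge0// normc_sqr real_normK ?num_real//.
by rewrite lerDr sqr_ge0.
Qed.

Lemma normc_le_ReIm z : normc z <= `|Re z| + `|Im z|.
Proof.
rewrite -(@ler_pXn2r _ 2)// ?nnegrE ?normc_ge0 ?addr_ge0// normc_sqr.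
rewrite sqrrD !real_normK ?num_real// -addrA lerD2l -[leLHS]add0r.
by rewrite lerD// mulrn_wge0// mulr_ge0.
Qed.

End ComplexNumbers.

(** * Inner product spaces *)

Section InnerProduct.
Context {R : realType} {V : innerProductType R}.
Implicit Types (x y z : V) (a : R[i]).

Lemma inner0l z : inner (0 : V) z = 0.
Proof.
have := inner_linearl z 1 0 0.
by rewrite scaler0 addr0 mul1r => /esym/eqP; rewrite -subr_eq0 addrK => /eqP.
Qed.

Lemma innerZl a x z : inner (a *: x) z = a * inner x z.
Proof. by rewrite -[a *: x]addr0 inner_linearl inner0l addr0. Qed.

Lemma innerDl x y z : inner (x + y) z = inner x z + inner y z.
Proof. by rewrite -[x in LHS]scale1r inner_linearl mul1r. Qed.

Lemma innerNl x z : inner (- x) z = - inner x z.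
Proof. by rewrite -scaleN1r innerZl mulN1r. Qed.

Lemma innerBl x y z : inner (x - y) z = inner x z - inner y z.
Proof. by rewrite innerDl innerNl. Qed.

Lemma innerDr z x y : inner z (x + y) = inner z x + inner z y.
Proof.
rewrite [LHS]inner_conjc [inner z x]inner_conjc [inner z y]inner_conjc.
by rewrite innerDl rmorphD.
Qed.

Lemma innerZr a z x : inner z (a *: x) = conjc a * inner z x.
Proof. by rewrite [LHS]inner_conjc [inner z x]inner_conjc innerZl rmorphM. Qed.

Lemma inner0r z : inner z (0 : V) = 0.
Proof. by rewrite inner_conjc inner0l rmorph0. Qed.

Lemma innerNr z x : inner z (- x) = - inner z x.
Proof. by rewrite [LHS]inner_conjc [inner z x]inner_conjc innerNl rmorphN. Qed.

Lemma innerBr z x y : inner z (x - y) = inner z x - inner z y.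
Proof. by rewrite innerDr innerNr. Qed.

Lemma hnorm_ge0 x : 0 <= hnorm x.
Proof. exact: sqrtr_ge0. Qed.

Lemma inner_hnorm x : inner x x = (hnorm x ^+ 2)%:C.
Proof.
have := inner_ge0 x; rewrite lecE /= => /andP[/eqP i0 r0].
by rewrite /hnorm sqr_sqrtr// [LHS]complexE i0 mulr0 addr0.
Qed.

Lemma hnorm_sqr x : hnorm x ^+ 2 = Re (inner x x).
Proof. by rewrite inner_hnorm. Qed.

Lemma hnormZ a x : hnorm (a *: x) = normc a * hnorm x.
Proof.
apply/eqP; rewrite -(@eqrXn2 _ 2)// ?mulr_ge0 ?hnorm_ge0 ?normc_ge0//.
rewrite hnorm_sqr innerZl innerZr mulrA mulcJ inner_hnorm -rmorphM /=.
by rewrite exprMn.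
Qed.

Lemma hnormN x : hnorm (- x) = hnorm x.
Proof. by rewrite /hnorm innerNl innerNr opprK. Qed.

Lemma hnorm0 : hnorm (0 : V) = 0.
Proof. by rewrite /hnorm inner0l sqrtr0. Qed.

Lemma hnorm0_eq0 x : hnorm x = 0 -> x = 0.
Proof. by move=> x0; apply: inner_eq0; rewrite inner_hnorm x0 expr0n. Qed.

(** Vectors are determined by their inner products, so that an identity between
    linear combinations reduces to a ring identity between scalars. *)
Lemma inner_ext x y : (forall z, inner x z = inner y z) -> x = y.
Proof.
move=> xy; apply/eqP; rewrite -subr_eq0; apply/eqP/inner_eq0.
by rewrite innerBl xy subrr.
Qed.

(** Expand the squared norm of [|y|^2 x - <x, y> y], which is nonnegative. *)
Lemma cauchy_schwarz x y : normc (inner x y) <= hnorm x * hnorm y.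
Proof.
have [->|/eqP y0] := pselect (y = 0); first by rewrite inner0r Normc.normc0 hnorm0 mulr0.
have hy : 0 < hnorm y.
  by rewrite lt_neqAle hnorm_ge0 andbT eq_sym; apply/eqP => /hnorm0_eq0/eqP; apply/negP.
rewrite -(@ler_pXn2r _ 2)// ?nnegrE ?normc_ge0 ?mulr_ge0 ?hnorm_ge0//.
pose b := (hnorm y ^+ 2)%:C : R[i]; pose s := inner x y.
have bJ : conjc b = b by rewrite /b /= oppr0.
have := inner_ge0 (b *: x - s *: y).
rewrite innerBl !innerBr !innerZl !innerZr bJ !inner_hnorm -/b -/s.
rewrite (inner_conjc y x) -/s.
rewrite [X in 0 <= X](_ : _ = b * (b * (hnorm x ^+ 2)%:C - s * conjc s)); last by ring.
rewrite mulcJ /b -!rmorphM -rmorphB -rmorphM ler0c.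
rewrite pmulr_rge0 ?exprn_gt0// subr_ge0 mulrC => /le_trans; apply.
by rewrite exprMn.
Qed.

Lemma hnormD x y : hnorm (x + y) <= hnorm x + hnorm y.
Proof.
rewrite -(@ler_pXn2r _ 2)// ?nnegrE ?addr_ge0 ?hnorm_ge0//.
rewrite hnorm_sqr innerDl !innerDr [inner y x]inner_conjc !inner_hnorm sqrrD.
have := le_trans (ler_norm _) (le_trans (le_Re_normc _) (cauchy_schwarz x y)).
case: (inner x y) => u v /= h; lra.
Qed.

Lemma hcvg_innerr (u : nat -> V) x w : hcvg u x ->
  forall e : R, 0 < e ->
    exists N, forall n, (N <= n)%N -> normc (inner w (u n) - inner w x) < e.
Proof.
move=> ux e e0; have hw : 0 < hnorm w + 1 by rewrite ltr_wpDl ?hnorm_ge0.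
move/cvgrPdist_lt : ux => /(_ _ (divr_gt0 e0 hw))[N _ HN].
exists N => n /HN; rewrite sub0r normrN ger0_norm ?hnorm_ge0//.
rewrite ltr_pdivlMr// => He; rewrite -innerBr.
apply: le_lt_trans (cauchy_schwarz _ _) _; rewrite mulrC.
by apply: le_lt_trans He; rewrite ler_wpM2l ?hnorm_ge0// lerDl.
Qed.

End InnerProduct.

Section ProductSpace.
Context {R : realType} {V W : innerProductType R}.

Lemma inner_pairE (z w : V * W) : inner z w = inner z.1 w.1 + inner z.2 w.2.
Proof. by []. Qed.

Lemma hnorm_pair_le (z : V * W) : hnorm z <= hnorm z.1 + hnorm z.2.
Proof.
rewrite -(@ler_pXn2r _ 2)// ?nnegrE ?addr_ge0 ?hnorm_ge0//.
rewrite hnorm_sqr inner_pairE !inner_hnorm sqrrD /=.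
by rewrite addrAC lerDl mulrn_wge0// mulr_ge0// hnorm_ge0.
Qed.

Lemma hnorm_fst_le (z : V * W) : hnorm z.1 <= hnorm z.
Proof.
rewrite -(@ler_pXn2r _ 2)// ?nnegrE ?hnorm_ge0//.
by rewrite (hnorm_sqr z) inner_pairE !inner_hnorm /= lerDl exprn_ge0// hnorm_ge0.
Qed.

Lemma hnorm_snd_le (z : V * W) : hnorm z.2 <= hnorm z.
Proof.
rewrite -(@ler_pXn2r _ 2)// ?nnegrE ?hnorm_ge0//.
by rewrite (hnorm_sqr z) inner_pairE !inner_hnorm /= lerDr exprn_ge0// hnorm_ge0.
Qed.

End ProductSpace.

Ltac linear_comb :=
  apply: inner_ext => ?; rewrite !(innerDl, innerNl, innerZl, inner0l); ring.

(** * Operators, adjoints and shifts *)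

Section Operators.
Context {R : realType} {V : innerProductType R}.
Implicit Types (T : operator V) (x y z : V).

(** The defining identity of the adjoint passes to the limit by continuity of the
    inner product. *)
Lemma adjoint_closed T : closed_operator (adjoint T).
Proof.
move=> u v x y Tuv ux vy z w Tzw; apply/eqP; rewrite -subr_eq0.
apply/eqP/Normc.eq0_normc/eqP; rewrite eq_le normc_ge0 andbT.
apply/ler_addgt0Pr => e e0; rewrite add0r [leRHS]splitr.
have e20 : 0 < e / 2 by rewrite divr_gt0.
have [N HN] := hcvg_innerr w ux e20; have [M HM] := hcvg_innerr z vy e20.
pose n := maxn N M.
rewrite (_ : _ - _ = - (inner w (u n) - inner w x) + (inner z (v n) - inner z y)).
  apply: le_trans (le_normcD _ _) _; rewrite normcN lerD//; apply/ltW.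
    by apply: HN; exact: leq_maxl.
  by apply: HM; exact: leq_maxr.
by rewrite (Tuv n _ _ Tzw); ring.
Qed.

(** If [z <> 0], a point [y] of the domain with [|z - y| < |z|] would give
    [|z|^2 = <z - y, z> < |z|^2]. *)
Lemma dense_orthogonal T z : densely_defined T ->
  (forall x, dom T x -> inner x z = 0) -> z = 0.
Proof.
move=> dT Tz; apply: hnorm0_eq0; apply/eqP; rewrite eq_le hnorm_ge0 andbT.
rewrite leNgt; apply/negP => z0; have [y /Tz yz] := dT z _ z0.
have : inner z z = inner (z - y) z by rewrite innerBl yz subr0.
rewrite inner_hnorm => zz; have := cauchy_schwarz (z - y) z; rewrite -zz.
rewrite [normc _](_ : _ = hnorm z ^+ 2); last first.
  by rewrite /= expr0n addr0 sqrtr_sqr ger0_norm// exprn_ge0// ltW.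
by rewrite expr2 ler_pM2r// leNgt => /negP.
Qed.

Lemma adjoint_is_operator T : densely_defined T -> is_operator (adjoint T).
Proof.
move=> dT; split.
- by move=> x w _; rewrite !inner0r.
- move=> a x y x' y' xy x'y' z w zw.
  by rewrite !innerDr !innerZr (xy _ _ zw) (x'y' _ _ zw).
- move=> x y y' xy xy'; apply/eqP; rewrite -subr_eq0; apply/eqP.
  apply: (dense_orthogonal dT) => z [w zw].
  by rewrite innerBr -(xy _ _ zw) -(xy' _ _ zw) subrr.
Qed.

Lemma self_adjoint_is_operator T : self_adjoint T -> is_operator T.
Proof. by move=> [dT ->]; exact: adjoint_is_operator. Qed.

Lemma self_adjoint_closed T : self_adjoint T -> closed_operator T.
Proof. by move=> [_ ->]; exact: adjoint_closed. Qed.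

Lemma self_adjoint_sym T x y a b : self_adjoint T -> T x a -> T y b ->
  inner a y = inner x b.
Proof. by move=> [_ TE]; rewrite [in T y]TE => xa; apply. Qed.

Lemma opP S T : (forall x y, S x y <-> T x y) -> S = T.
Proof. by move=> ST; apply/funext => x; apply/funext => y; exact/propext. Qed.

Lemma is_operatorD T : is_operator T ->
  forall x x' y y', T x y -> T x' y' -> T (x + x') (y + y').
Proof.
by move=> [_ TL _] x x' y y' xy xy'; rewrite -(scale1r x) -(scale1r y); exact: TL.
Qed.

Lemma is_operatorZ T : is_operator T ->
  forall (a : R[i]) x y, T x y -> T (a *: x) (a *: y).
Proof.
move=> [T0 TL _] a x y xy.
by rewrite -[_ *: x]addr0 -[_ *: y]addr0; exact: TL.
Qed.

Lemma is_operatorB T : is_operator T ->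
  forall x x' y y', T x y -> T x' y' -> T (x - x') (y - y').
Proof.
move=> oT x x' y y' xy /(is_operatorZ oT (-1)); rewrite !scaleN1r.
exact: is_operatorD.
Qed.

End Operators.

Section Shifts.
Context {R : realType} {V : innerProductType R}.
Implicit Types (T : operator V) (x y z : V) (c : R[i]).

Lemma op_add_scalarE T c x y : op_add T (op_scalar c) x y <-> T x (y - c *: x).
Proof.
split=> [[a [b [Txa -> ->]]]|Txy]; first by rewrite addrK.
by exists (y - c *: x), (c *: x); split; rewrite // subrK.
Qed.

Lemma shiftE T c x y : Defs.shift T c x y <-> T x (y + c *: x).
Proof. by rewrite /Defs.shift op_add_scalarE scaleNr opprK. Qed.

Lemma densely_defined_total T : (forall x, dom T x) -> densely_defined T.
Proof. by move=> Tx x e e0; exists x => //; rewrite subrr hnorm0. Qed.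

Lemma self_adjoint_op_scalar0 : self_adjoint (op_scalar 0 : operator V).
Proof.
split; first by apply: densely_defined_total => x; exists 0; rewrite /op_scalar scale0r.
apply: opP => x y; split=> [->|].
  by move=> z w ->; rewrite !scale0r inner0l inner0r.
move=> xy; rewrite /op_scalar scale0r; apply: inner_eq0.
by rewrite -(xy y 0) ?inner0l// /op_scalar scale0r.
Qed.

Lemma self_adjoint_add_scalar T c : conjc c = c -> self_adjoint T ->
  self_adjoint (op_add T (op_scalar c)).
Proof.
move=> cJ [dT TE]; split.
  move=> x e /(dT x)[y [w Tyw] xy]; exists y => //.
  by exists (w + c *: y); apply/op_add_scalarE; rewrite addrK.
apply: opP => x y; rewrite op_add_scalarE [in T _]TE; split => xy z w.
  move=> /op_add_scalarE /xy; rewrite innerBl innerBr innerZl innerZr cJ.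
  by move=> /eqP; rewrite subr_eq subrK => /eqP.
move=> zw; have /xy : op_add T (op_scalar c) z (w + c *: z).
  by apply/op_add_scalarE; rewrite addrK.
rewrite innerDl innerBr innerZl innerZr cJ => <-.
by rewrite addrK.
Qed.

Lemma point_spectrum_sub_spectrum T :
  T 0 0 -> point_spectrum T `<=` spectrum T.
Proof.
move=> T0 lam [x x0 Tx] [/(_ 0)[y [_ uy]] _]; apply: x0.
rewrite -(uy x); last by apply/shiftE; rewrite add0r.
by apply: uy; apply/shiftE; rewrite scaler0 addr0.
Qed.

(** Powers are defined by composing on the left, while root vectors are analysed by
    applying the operator once and descending. *)
Lemma op_powS_inner T n x z :
  op_pow T n.+1 x z -> exists2 y, T x y & op_pow T n y z.
Proof.
elim: n x z => [|n IH] x z.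
  by move=> [_ -> Tz]; rewrite scale1r in Tz; exists z; rewrite // /op_pow /= /op_scalar scale1r.
move=> [y /IH[w Txw Twy] Tyz]; exists w => //; by exists y.
Qed.

Lemma op_JE (z w : V * V) : @op_J R V z w <-> w = (z.2, - z.1).
Proof.
split=> [[a [b [c [d [-> -> -> -> ->]]]]]|->].
  by rewrite !scale0r !scale1r scaleN1r add0r addr0.
exists 0, z.2, (- z.1), 0; rewrite /op_scalar !scale0r !scale1r scaleN1r.
by rewrite add0r addr0.
Qed.

End Shifts.

(** * The Hamiltonian block operator of a self-adjoint operator *)

Section HamiltonianOfSelfAdjoint.
Context {R : realType} {V : innerProductType R} (A : operator V).
Hypothesis sA : self_adjoint A.

Let oA : is_operator A. Proof. exact: self_adjoint_is_operator. Qed.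

Local Notation H :=
  (block_op A (op_add A (op_scalar 1)) (op_scalar 0) (op_opp A)).

Lemma block_hamiltonianE (z w : V * V) : H z w <->
  exists a b, [/\ A z.1 a, A z.2 b & w = (a + b + z.2, - b)].
Proof.
split.
  move=> [a [b' [c [d [Aa /op_add_scalarE Ab -> Ad ->]]]]].
  rewrite scale1r in Ab; have [_ _ /(_ _ _ _ Ab Ad) bd] := oA.
  exists a, (b' - z.2); split => //.
  by rewrite -addrA subrK scale0r add0r bd opprK.
move=> [a [b [Aa Ab ->]]]; exists a, (b + z.2), 0, (- b); split => //.
- by apply/op_add_scalarE; rewrite scale1r addrK.
- by rewrite /op_scalar scale0r.
- by rewrite /op_opp opprK.
- by rewrite add0r addrA.
Qed.

Lemma op_JHE (z w : V * V) : op_comp (@op_J R V) H z w <->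
  exists a b, [/\ A z.1 a, A z.2 b & w = (- b, - (a + b + z.2))].
Proof.
split=> [[y /block_hamiltonianE[a [b [Aa Ab ->]]] /op_JE ->]|[a [b [Aa Ab ->]]]].
  by exists a, b.
exists (a + b + z.2, - b); last exact/op_JE.
by apply/block_hamiltonianE; exists a, b.
Qed.

Lemma densely_defined_block_hamiltonian : densely_defined H.
Proof.
move=> x e e0; have e20 : 0 < e / 2 by rewrite divr_gt0.
have [dA _] := sA.
have [y1 [a Aa] xy1] := dA x.1 _ e20; have [y2 [b Ab] xy2] := dA x.2 _ e20.
exists (y1, y2).
  by exists (a + b + y2, - b); apply/block_hamiltonianE; exists a, b.
by apply: le_lt_trans (hnorm_pair_le _) _; rewrite [ltRHS]splitr ltrD.
Qed.

(** If [(z, w)] is in the graph of the adjoint of [J H], pairing with [(x, 0)] gives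
    [A z.2 = - w.1], and then pairing with [(0, x)] gives
    [A z.1 = - A z.2 - z.2 - w.2]. *)
Lemma symplectic_self_adjoint_block :
  symplectic_self_adjoint A (op_add A (op_scalar 1)) (op_scalar 0) (op_opp A).
Proof.
split.
  have sB : self_adjoint (op_add A (op_scalar 1)).
    by apply: self_adjoint_add_scalar => //; rewrite rmorph1.
  have sC := @self_adjoint_op_scalar0 R V.
  split; [|by split; [exact: self_adjoint_is_operator|exact: self_adjoint_closed|]..| |].
  - by split; [exact: oA|exact: self_adjoint_closed|case: sA].
  - by case: sA => _ <-.
  - exact: densely_defined_block_hamiltonian.
move=> JH; apply: opP => z w; split.
  move=> /op_JHE[a [b [Aa Ab ->]]] x _ /op_JHE[c [d [Ac Ad ->]]].
  rewrite !inner_pairE /= !(innerNl, innerNr, innerDl, innerDr).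
  have sym x1 x2 y1 y2 : A x1 y1 -> A x2 y2 -> inner y1 x2 = inner x1 y2.
    exact: self_adjoint_sym.
  by rewrite (sym _ _ _ _ Ad Aa) (sym _ _ _ _ Ac Ab) (sym _ _ _ _ Ad Ab); ring.
move=> zw.
have AE x y : A x y <-> adjoint A x y by rewrite {1}(proj2 sA).
have A0 : A 0 0 by case: oA.
have A2 : A z.2 (- w.1).
  apply/AE => x a Aa.
  have /zw : JH (x, 0) (0, - a).
    by apply/op_JHE; exists a, 0; rewrite oppr0 /= !addr0.
  rewrite !inner_pairE /= !(inner0l, innerNl, innerNr) add0r addr0.
  by move=> /esym ->; rewrite opprK.
have A1 : A z.1 (- w.2 - z.2 + w.1).
  apply/AE => x b Ab.
  have /zw : JH (0, x) (- b, - (b + x)).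
    by apply/op_JHE; exists 0, b; rewrite add0r.
  rewrite !inner_pairE /= !(inner0l, innerNl, innerNr, innerDl, innerDr).
  rewrite (self_adjoint_sym sA Ab A2) innerNr => E.
  rewrite add0r in E; rewrite -E; ring.
apply/op_JHE; exists (- w.2 - z.2 + w.1), (- w.1); split => //.
by rewrite opprK addrK subrK opprK; case: (w).
Qed.

End HamiltonianOfSelfAdjoint.

(** * Resolvent and root subspaces of the block operator *)

Section SpectrumOfTheBlockOperator.
Context {R : realType} {V : innerProductType R} (A : operator V).
Hypothesis sA : self_adjoint A.

Let oA : is_operator A. Proof. exact: self_adjoint_is_operator. Qed.

Local Notation H :=
  (block_op A (op_add A (op_scalar 1)) (op_scalar 0) (op_opp A)).

(** The second row is used to eliminate the unbounded term [(A + 1) z.2] from the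
    first: [(A + 1) z.2 = - w.2 + (1 - lam) z.2]. The right-hand sides then depend
    boundedly on [w] and [z.2]. *)
Lemma shift_block_hamiltonianE lam (z w : V * V) : Defs.shift H lam z w <->
  Defs.shift A (- lam) z.2 (- w.2) /\
  Defs.shift A lam z.1 (w.1 + w.2 + (lam - 1) *: z.2).
Proof.
rewrite !shiftE block_hamiltonianE//; split.
  move=> [a [b [Aa Ab [/= E1 E2]]]].
  have Eb : b = - w.2 + - lam *: z.2 by rewrite -[b]opprK -E2 opprD scaleNr.
  have Ea : a = w.1 + w.2 + (lam - 1) *: z.2 + lam *: z.1.
    rewrite [LHS](_ : _ = (a + b + z.2) - b - z.2); last by linear_comb.
    by rewrite -E1 Eb; linear_comb.
  by rewrite -Eb -Ea.
move=> [A2 A1]; do 2!eexists; split; [exact: A1|exact: A2|].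
by congr pair => /=; linear_comb.
Qed.

Lemma resolvent_set_block_hamiltonian lam :
  resolvent_set A lam -> resolvent_set A (- lam) -> resolvent_set H lam.
Proof.
move=> [ex1 [M1 bd1]] [ex2 [M2 bd2]]; split.
  move=> w; have [z2 [Az2 uz2]] := ex2 (- w.2).
  have [z1 [Az1 uz1]] := ex1 (w.1 + w.2 + (lam - 1) *: z2).
  exists (z1, z2); split; first exact/shift_block_hamiltonianE.
  move=> [y1 y2] /shift_block_hamiltonianE[/= /uz2 <-{y2} /uz1 <-].
  by [].
exists (`|M1| * (2 + normc (lam - 1) * `|M2|) + `|M2|) => z w.
move=> /shift_block_hamiltonianE[/bd2 h2 /bd1 h1].
rewrite hnormN in h2.
have w1 := hnorm_fst_le w; have w2 := hnorm_snd_le w.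
have H2 : hnorm z.2 <= `|M2| * hnorm w.
  apply: le_trans h2 _; apply: le_trans (ler_wpM2r (hnorm_ge0 _) (ler_norm _)) _.
  by rewrite ler_wpM2l.
have H1 : hnorm (w.1 + w.2 + (lam - 1) *: z.2) <=
    (2 + normc (lam - 1) * `|M2|) * hnorm w.
  apply: le_trans (hnormD _ _) _; rewrite hnormZ mulrDl lerD//.
    apply: le_trans (hnormD _ _) _; lra.
  by rewrite -mulrA ler_wpM2l// normc_ge0.
apply: le_trans (hnorm_pair_le _) _; rewrite mulrDl lerD//.
apply: le_trans h1 _; apply: le_trans (ler_wpM2r (hnorm_ge0 _) (ler_norm _)) _.
by rewrite -mulrA ler_wpM2l.
Qed.

Lemma block_hamiltonian0 : H 0 0.
Proof.
apply/block_hamiltonianE => //; exists 0, 0; case: oA => A0 _ _.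
by split => //; rewrite oppr0 !addr0.
Qed.

Lemma point_spectrum_block_hamiltonian lam :
  point_spectrum A lam -> point_spectrum H lam.
Proof.
move=> [x x0 Ax]; exists (x, 0); first by move=> [].
apply/block_hamiltonianE => //; exists (lam *: x), 0; case: oA => A0 _ _.
split=> //=.
by rewrite oppr0 !addr0; congr pair; rewrite /= scaler0.
Qed.

Lemma self_adjoint_shift_sym lam x y a b : conjc lam = lam ->
  A x (a + lam *: x) -> A y (b + lam *: y) -> inner a y = inner x b.
Proof.
move=> lamJ Ax Ay; have := self_adjoint_sym sA Ax Ay.
by rewrite innerDl innerDr innerZl innerZr lamJ => /addIr.
Qed.

(** There are no Jordan blocks, because
    [|a|^2 = <(A - lam) x, a> = <x, (A - lam) a> = 0]. *)
Lemma self_adjoint_no_jordan lam x a : conjc lam = lam ->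
  A x (a + lam *: x) -> A a (lam *: a) -> a = 0.
Proof.
move=> lamJ Ax Aa; apply: inner_eq0.
by rewrite (@self_adjoint_shift_sym lam x a a 0)// ?inner0r// add0r.
Qed.

Let eig lam : set V := [set x | A x (lam *: x)].

Let eigsum lam : set V :=
  [set x | exists a b, [/\ eig lam a, eig (- lam) b & x = a + b]].

Let eigD lam x y : eig lam x -> eig lam y -> eig lam (x + y).
Proof. by rewrite /eig /= => Ax Ay; rewrite scalerDr; exact: is_operatorD. Qed.

Let eigZ lam c x : eig lam x -> eig lam (c *: x).
Proof.
rewrite /eig /= => /(is_operatorZ oA c).
by rewrite !scalerA mulrC.
Qed.

(** Let [(A - lam) x = a + b] with [a], [b] in the kernels of [A - lam] and [A + lam].
    If [lam <> 0], then [(A - lam) b = - 2 lam b], so [y = x + (2 lam)^-1 b] satisfies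
    [(A - lam) y = a]; hence [a = 0] and [y] is in the kernel of [A - lam]. If
    [lam = 0], the two kernels coincide and [a + b = 0]. *)
Let eigsum_ker lam x w : conjc lam = lam ->
  A x (w + lam *: x) -> eigsum lam w -> eigsum lam x.
Proof.
move=> lamJ Ax [a [b [ea eb wE]]].
have [lam0|/eqP lam0] := pselect (lam = 0).
  rewrite lam0 oppr0 scale0r addr0 in ea eb Ax *.
  have w0 : w = 0.
    apply: (@self_adjoint_no_jordan 0 x); rewrite ?rmorph0// ?scale0r ?addr0//.
    by have := eigD ea eb; rewrite /eig /= scale0r wE.
  exists x, 0; split; rewrite ?addr0//; first by rewrite /eig /= scale0r -w0.
  by rewrite /eig /= scaler0; case: oA.
pose y := x + (2 * lam)^-1 *: b.
have Ay : A y (a + lam *: y).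
  have := is_operatorD oA Ax (is_operatorZ oA (2 * lam)^-1 eb).
  rewrite -/y wE [X in A y X](_ : _ = a + lam *: y)// /y.
  by apply: inner_ext => t; rewrite !(innerDl, innerZl); field.
have a0 := self_adjoint_no_jordan lamJ Ay ea.
exists y, (- (2 * lam)^-1 *: b); split; last by rewrite scaleNr addrK.
- by have := Ay; rewrite a0 add0r.
- exact: eigZ.
Qed.

(** Let [z = (x, y)]. The equation [(A + lam)^n y = 0] forces [(A + lam) y = 0]. Then,
    by induction on [n], [(A - lam) x] lies in the sum of the kernels of [A - lam]
    and [A + lam], and so does [x]. *)
Lemma root_subspace_block_hamiltonian lam (z : V * V) : conjc lam = lam ->
  root_subspace H lam z ->
  A z.2 (- lam *: z.2) /\
  exists a b, [/\ A a (lam *: a), A b (- lam *: b) & z.1 = a + b].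
Proof.
move=> lamJ [n]; elim: n z => [|n IH] z.
  rewrite /op_pow /= /op_scalar scale1r => <- /=.
  rewrite scaler0; case: (oA) => A0 _ _; split=> //.
  by exists 0, 0; rewrite !scaler0 addr0.
move=> /op_powS_inner[w /shift_block_hamiltonianE[/shiftE A2 /shiftE A1] /IH[w2 w1]].
have lamNJ : conjc (- lam) = - lam by rewrite rmorphN /= lamJ.
have w20 : w.2 = 0.
  apply/eqP; rewrite -oppr_eq0; apply/eqP.
  apply: self_adjoint_no_jordan lamNJ A2 _.
  by have := is_operatorZ oA (-1) w2; rewrite !scaleN1r scalerN.
have z2 : eig (- lam) z.2 by have := A2; rewrite w20 oppr0 add0r.
split=> //; apply: eigsum_ker lamJ A1 _.
move: w1 => [a [b [ea eb ->]]]; exists a, (b + (lam - 1) *: z.2).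
rewrite w20 addr0 addrA; split=> //.
by apply: eigD => //; exact: eigZ.
Qed.

Lemma finite_algebraic_multiplicity_block_hamiltonian lam (phi psi : V) :
  conjc lam = lam ->
  (forall x, A x (lam *: x) -> exists c, x = c *: phi) ->
  (forall x, A x (- lam *: x) -> exists c, x = c *: psi) ->
  finite_algebraic_multiplicity H lam.
Proof.
move=> lamJ kphi kpsi.
pose v : 'I_3 -> V * V := fun i => nth (0, psi) [:: (phi, 0); (psi, 0)] i.
exists 3%N, v => z /(root_subspace_block_hamiltonian lamJ)[/kpsi[c3 z2]].
move=> [_ [_ [/kphi[c1 ->] /kpsi[c2 ->] z1]]].
exists (fun i : 'I_3 => nth c3 [:: c1; c2] i).
rewrite !big_ord_recl big_ord0 /v /= addr0.
rewrite [LHS]surjective_pairing z1 z2; congr pair => /=; first by linear_comb.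
by linear_comb.
Qed.

End SpectrumOfTheBlockOperator.

(** * Absolutely continuous functions *)

Section AbsoluteContinuity.
Context {R : realType}.
Local Notation mu := (@lebesgue_measure R).
Local Notation I01 := (`]0%R, 1%R[%classic : set R).
Implicit Types (f g h : R -> R[i]) (s : seq (R * R)).

Local Notation AC := (absolutely_continuous 0 1).

Local Notation nonoverlapping :=
  (pairwise (fun p q : R * R => (p.2 <= q.1) || (q.2 <= p.1))).

#[global] Instance ae_lebesgue_filter : Filter (nbhs (almost_everywhere mu)).
Proof. exact: (ae_filter_ringOfSetsType mu). Qed.

(** All closure properties of absolute continuity used below (real and imaginary
    parts, sums, products, Lipschitz functions) have this form. *)
Lemma AC_dominated f g h (K : R) : AC g -> AC h ->
  (forall a b, 0 <= a -> a <= b -> b <= 1 ->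
    normc (f b - f a) <= K * (normc (g b - g a) + normc (h b - h a))) -> AC f.
Proof.
move=> ACg ACh fgh e e0.
have K0 : 0 < `|K| + 1 by rewrite ltr_wpDl.
have e'0 : 0 < e / (`|K| + 1) / 2 by rewrite !divr_gt0.
have [d1 d10 H1] := ACg _ e'0; have [d2 d20 H2] := ACh _ e'0.
exists (Num.min d1 d2) => [|s s01 sno]; first by rewrite lt_min d10.
rewrite lt_min => /andP[sd1 sd2].
have {}H1 := H1 _ s01 sno sd1; have {}H2 := H2 _ s01 sno sd2.
have -> : e = (`|K| + 1) * (e / (`|K| + 1) / 2 + e / (`|K| + 1) / 2).
  by field; rewrite gt_eqF.
apply: (@le_lt_trans _ _ ((`|K| + 1) *
    (\sum_(p <- s) normc (g p.2 - g p.1) + \sum_(p <- s) normc (h p.2 - h p.1)))).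
  rewrite -big_split /= mulr_sumr big_seq [leRHS]big_seq; apply: ler_sum => p ps.
  have /and3P[p0 p12 p1] := s01 _ ps.
  apply: le_trans (fgh _ _ p0 p12 p1) _; apply: ler_wpM2r.
    by rewrite addr_ge0// normc_ge0.
  by rewrite (le_trans (ler_norm _))// lerDl.
by rewrite ltr_pM2l// ltrD.
Qed.

Lemma AC_id : AC (fun t : R => t%:C).
Proof.
move=> e e0; exists e => // s s01 _; apply: le_lt_trans.
rewrite big_seq [leRHS]big_seq; apply: ler_sum => p /s01/and3P[_ p12 _].
by rewrite -rmorphB /= expr0n addr0 sqrtr_sqr ger0_norm// subr_ge0.
Qed.

Lemma AC_lipschitz f (K : R) :
  (forall a b, 0 <= a -> a <= b -> b <= 1 -> normc (f b - f a) <= K * (b - a)) ->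
  AC f.
Proof.
move=> fK; apply: (AC_dominated (K := K / 2) AC_id AC_id) => a b a0 ab b1.
rewrite -!rmorphB /= expr0n addr0 sqrtr_sqr ger0_norm ?subr_ge0//.
apply: le_trans (fK _ _ a0 ab b1) _.
by rewrite -mulr2n -[X in K / 2 * X]mulr_natl mulrA divfK ?pnatr_eq0.
Qed.

Lemma AC_cst (c : R[i]) : AC (fun _ : R => c).
Proof. by apply: (@AC_lipschitz _ 0) => *; rewrite subrr Normc.normc0 mul0r. Qed.

Lemma AC_continuous f : AC f -> forall e : R, 0 < e -> exists2 d : R, 0 < d &
  forall a b, 0 <= a <= 1 -> 0 <= b <= 1 -> `|b - a| < d -> normc (f b - f a) < e.
Proof.
move=> ACf e /ACf[d d0 H]; exists d => // a b.
wlog ab : a b / a <= b.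
  move=> W a01 b01; have [|/ltW] := leP a b; first by move=> /W; exact.
  by move=> /W /(_ b01 a01); rewrite distrC -normcN opprB.
move=> /andP[a0 a1] /andP[b0 b1]; rewrite ger0_norm ?subr_ge0// => bad.
have := H [:: (a, b)]; rewrite !big_seq1 /=; apply => //.
by move=> p; rewrite inE => /eqP -> /=; rewrite a0 ab b1.
Qed.

(** Remove the first interval from [E]; being half-open, the others do not meet it. *)
Lemma sum_integral_nonoverlapping (phi : R -> \bar R) s (E : set R) :
  (forall x, 0%E <= phi x)%E -> measurable_fun setT phi -> measurable E ->
  (forall p, p \in s -> `]p.1, p.2]%classic `<=` E) ->
  nonoverlapping s ->
  (\sum_(p <- s) \int[mu]_(x in `]p.1, p.2]) phi x <= \int[mu]_(x in E) phi x)%E.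
Proof.
move=> phi0 mphi; elim: s E => [|p s IH] E mE sE /=.
  by rewrite big_nil integral_ge0.
move=> /andP[/allP ps nos]; rewrite big_cons.
have pE : `]p.1, p.2]%classic `<=` E by apply: sE; rewrite mem_head.
have mp : measurable (`]p.1, p.2]%classic : set R) by exact: measurable_itv.
have mphiE D : measurable_fun D phi by exact: measurable_funTS.
have mEp : measurable (E `\` `]p.1, p.2]) by exact: measurableD.
rewrite -(setDUK pE) ge0_integral_setU//; [|exact: mphiE|]; last first.
  by apply/disj_setPS => x [xp [_ /(_ xp)]].
apply: leeD2l.
apply: IH => //.
move=> q qs x xq; split; first by apply: (sE q) => //; rewrite in_cons qs orbT.
move: xq => /= /[!in_itv]/= /andP[q1x xq2] /andP[p1x xp2].
have /orP[h|h] := ps _ qs.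
- by have := le_lt_trans (le_trans xp2 h) q1x; rewrite ltxx.
- by have := le_lt_trans (le_trans xq2 h) p1x; rewrite ltxx.
Qed.

Lemma sum_length_nonoverlapping s (E : set R) : measurable E ->
  (forall p, p \in s -> p.1 <= p.2 /\ `]p.1, p.2]%classic `<=` E) ->
  nonoverlapping s -> ((\sum_(p <- s) (p.2 - p.1))%:E <= mu E)%E.
Proof.
move=> mE sE nos; have := @sum_integral_nonoverlapping (cst 1%E) s E.
rewrite integral_cst// mul1e => H; apply: le_trans (H _ _ _ _ _) => //.
- rewrite -sumEFin big_seq [leRHS]big_seq; apply: lee_sum => p /sE[p12 _].
  rewrite integral_cst// mul1e [leRHS]lebesgue_measure_itv /= lte_fin.
  by case: ltP => // p21; rewrite lee_fin subr_le0.
- by move=> p /sE[].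
Qed.

(** The supremum of the points of [0, t] where [P] holds can be crossed, so it is
    attained and equal to [t]. *)
Lemma real_induction (P : R -> Prop) t : 0 <= t -> P 0 ->
  (forall x, 0 <= x <= t -> exists2 r, 0 < r & forall y z,
     0 <= y <= x -> x <= z <= t -> x - r < y -> z < x + r -> P y -> P z) ->
  P t.
Proof.
move=> t0 P0 step; pose S := [set x | 0 <= x <= t /\ P x].
have S0 : S 0 by split=> //; rewrite lexx t0.
have supS : has_sup S by split; [exists 0|exists t => x [/andP[]]].
set c := sup S.
have c0 : 0 <= c by apply: (sup_upper_bound supS).
have ct : c <= t by apply: ge_sup; [exists 0|move=> x [/andP[]]].
have [|r r0 Hr] := step c; first by rewrite c0.
have [y Sy cy] := sup_adherent r0 supS.
have yc : y <= c by apply: (sup_upper_bound supS).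
case: Sy => /andP[y0 yt] Py.
pose z := Num.min t (c + r / 2).
have cz : c <= z by rewrite le_min ct lerDl divr_ge0// ltW.
have Pz : P z.
  apply: (Hr y) => //; first by rewrite y0.
  - by rewrite cz ge_min lexx.
  - by rewrite gt_min [X in _ || X]ltrD2l ltr_pdivrMr// ltr_pMr// ltr1n orbT.
have zc : z <= c.
  apply: (sup_upper_bound supS); split=> //.
  by rewrite (le_trans c0 cz) ge_min lexx.
suff <- : z = t by [].
have : (t <= z) || (c + r / 2 <= z) by rewrite -ge_min lexx.
case/orP => [tz|]; first by apply/eqP; rewrite eq_le tz ge_min lexx.
by move=> /le_trans/(_ zc); rewrite gerDl leNgt divr_gt0.
Qed.

Lemma is_cderive0_near f x (e : R) : is_cderive f x 0 -> 0 < e ->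
  exists2 r, 0 < r & forall y, `|y - x| < r -> normc (f y - f x) <= e * `|y - x|.
Proof.
have real_case (g : R -> R) (e' : R) : is_derive x (1 : R) g 0 -> 0 < e' ->
    exists2 r, 0 < r & forall y, `|y - x| < r -> `|g y - g x| <= e' * `|y - x|.
  move=> [dg g'0] e'0.
  have : u^-1 *: (g (u + x) - g x) @[u --> 0^'] --> (0 : R).
    rewrite -[X in _ --> X]g'0.
    rewrite (_ : (fun u => _) = fun u => u^-1 *: ((g \o shift x) (u *: 1) - g x)).
      exact: dg.
    by apply/funext => u /=; rewrite [u *: 1]mulr1.
  move/cvgrPdist_le => /(_ _ e'0); rewrite near_withinE => /nbhs_ballP[r /= r0 Hr].
  exists r => // y yx; have [->|yx0] := eqVneq y x.
    by rewrite !subrr normr0 mulr0.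
  have := Hr (y - x); rewrite /ball /= sub0r normrN => /(_ yx).
  rewrite subr_eq0 => /(_ yx0); rewrite sub0r normrN subrK normrM normfV.
  by rewrite ler_pdivrMl ?normr_gt0 ?subr_eq0// mulrC.
move=> [fr fi] e0; have e20 : 0 < e / 2 by rewrite divr_gt0.
have [r1 r10 H1] := real_case _ _ fr e20; have [r2 r20 H2] := real_case _ _ fi e20.
exists (Num.min r1 r2) => [|y]; first by rewrite lt_min r10.
rewrite lt_min => /andP[/H1 h1 /H2 h2].
apply: le_trans (normc_le_ReIm _) _; rewrite !raddfB /=.
by apply: le_trans (lerD h1 h2) _; rewrite -mulrDl -splitr.
Qed.

(** Outer regularity of the Lebesgue measure, applied to the exceptional set of [Q]
    together with [N0]. *)
Lemma ae_open_cover (Q : R -> Prop) (N0 : set R) (e : R) :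
  0 < e -> {ae mu, forall x, Q x} -> measurable N0 -> mu N0 = 0%E ->
  exists U : set R, [/\ measurable U, open U, (mu U < e%:E)%E, N0 `<=` U &
    forall x, U x \/ Q x].
Proof.
move=> e0 [N [mN muN NQ]] mN0 muN0.
have mB : measurable (N `|` N0) by exact: measurableU.
have muB : mu (N `|` N0) = 0%E.
  by apply/eqP; rewrite eq_le measure_ge0 andbT -[leRHS]adde0 -{1}muN -muN0 measureU2.
have muBy : (mu (N `|` N0) < +oo)%E by rewrite muB.
have [U [oU BU UB]] := lebesgue_regularity_outer mB muBy e0.
exists U; split=> //.
- exact: open_measurable.
- have mU : measurable U by exact: open_measurable.
  rewrite -(setDUK BU); apply: le_lt_trans UB.
  rewrite -[leRHS]add0e -[X in (X + _)%E]muB; apply: measureU2 => //.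
  exact: measurableD.
- by move=> x N0x; apply: BU; right.
- move=> x; have [Ux|Ux] := pselect (U x); [by left|right].
  by apply: contrapT => Qx; apply: Ux; apply: BU; left; apply: NQ.
Qed.

(** Cover the points where the derivative is not known to vanish by an open set
    [U] of small measure. By induction along [0, t], the increment of [f] is at
    most [e t] plus its variation over finitely many disjoint intervals contained
    in [U]; the latter is small by absolute continuity. *)
Lemma AC_derive0_cst f : AC f ->
  {ae mu, forall x, 0 < x < 1 -> is_cderive f x 0} ->
  forall t, 0 <= t <= 1 -> f t = f 0.
Proof.
move=> ACf f'0 t /andP[t0 t1]; apply/eqP; rewrite -subr_eq0.
apply/eqP/Normc.eq0_normc/eqP; rewrite eq_le normc_ge0 andbT.
apply/ler_addgt0Pr => e0 e00; rewrite add0r.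
pose e := e0 / 2; have e_gt0 : 0 < e by rewrite divr_gt0.
have [d d0 Hd] := ACf _ e_gt0.
have [||U [mU oU Ud NU HU]] := @ae_open_cover _ ([set 0] `|` [set 1]) _ d0 f'0.
- by apply: measurableU; exact: measurable_set1.
- apply/eqP; rewrite eq_le measure_ge0 andbT.
  have : (mu ([set 0%R] `|` [set 1%R]) <= mu [set 0%R] + mu [set 1%R])%E.
    by apply: measureU2; exact: measurable_set1.
  by rewrite !lebesgue_measure_set1 adde0.
pose P tau := exists s : seq (R * R), [/\
  forall p, p \in s -> [&& 0 <= p.1, p.1 <= p.2 & p.2 <= tau],
  forall p, p \in s -> `]p.1, p.2]%classic `<=` U,
  nonoverlapping s &
  normc (f tau - f 0) <= \sum_(p <- s) normc (f p.2 - f p.1) + e * tau].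
suff [s [s01 sU nos Hs]] : P t.
  apply: le_trans Hs _; rewrite /e [leRHS]splitr lerD//.
    apply/ltW/Hd => //.
      by move=> p /s01/and3P[-> -> /le_trans]; exact.
    rewrite -lte_fin; apply: le_lt_trans Ud; apply: sum_length_nonoverlapping => //.
    by move=> p ps; split; [case/and3P : (s01 _ ps)|exact: sU].
  by rewrite ler_piMr// ltW.
apply: (@real_induction P) => //.
  by exists [::]; split => //; rewrite big_nil subrr Normc.normc0 mulr0 addr0.
move=> x /andP[x0 xt].
have [r r0 Hr] : exists2 r, 0 < r & forall y z, 0 <= y <= x -> x <= z <= t ->
    x - r < y -> z < x + r ->
    `]y, z]%classic `<=` U \/ normc (f z - f y) <= e * (z - y).
  have [Ux|Ux] := pselect (U x).
    have /nbhs_ballP[r /= r0 Hr] : nbhs x U by exact: open_nbhs_nbhs.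
    exists r => // y z _ _ xry zxr; left => w /= /[!in_itv]/= /andP[yw wz].
    by apply: Hr; rewrite /ball /= ltr_distlC (lt_trans xry yw) (le_lt_trans wz zxr).
  have x01 : 0 < x < 1.
    rewrite lt_neqAle x0 andbT; apply/andP; split.
      by apply/eqP => x_0; apply: Ux; apply: NU; left.
    rewrite lt_neqAle (le_trans xt t1) andbT.
    by apply/eqP => x_1; apply: Ux; apply: NU; right.
  have [//|/(_ x01) fx] := HU x.
  have [r r0 Hr] := is_cderive0_near fx e_gt0.
  exists r => // y z /andP[_ yx] /andP[xz _] xry zxr; right.
  rewrite [f z - f y](_ : _ = (f z - f x) + - (f y - f x)); last by ring.
  apply: le_trans (le_normcD _ _) _; rewrite normcN.
  have -> : e * (z - y) = e * `|z - x| + e * `|y - x|.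
    by rewrite (ger0_norm (_ : 0 <= z - x)) ?subr_ge0// ler0_norm ?subr_le0//; ring.
  by apply: lerD; apply: Hr; rewrite ltr_norml; apply/andP; split; lra.
exists r => // y z y0x xzt xry zxr [s [s01 sU nos Hs]].
have yz : y <= z by case/andP : y0x xzt => _ /le_trans yx /andP[/yx].
have y0 : 0 <= y by case/andP: y0x.
have tri : normc (f z - f 0) <= normc (f z - f y) + normc (f y - f 0).
  by rewrite [f z - f 0](_ : _ = (f z - f y) + (f y - f 0)) ?le_normcD//; ring.
have [yzU|yzE] := Hr _ _ y0x xzt xry zxr.
  exists ((y, z) :: s); split.
  - move=> p; rewrite inE => /predU1P[->/=|/s01/and3P[-> -> py]]; first by rewrite y0 yz lexx.
    by rewrite (le_trans py).
  - by move=> p; rewrite inE => /predU1P[->//|/sU].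
  - rewrite /= nos andbT; apply/allP => q /s01/and3P[_ _ q2y].
    by rewrite q2y orbT.
  - rewrite big_cons /= -addrA; apply: le_trans tri _; rewrite lerD2l.
    by apply: le_trans Hs _; rewrite lerD2l ler_pM2l.
exists s; split=> //.
  by move=> p /s01/and3P[-> -> py]; rewrite (le_trans py).
apply: le_trans tri _; apply: le_trans (lerD yzE Hs) _.
by rewrite addrCA -mulrDr subrK.
Qed.

Lemma AC_bounded f : AC f ->
  exists M, forall t, 0 <= t <= 1 -> normc (f t) <= M.
Proof.
move=> ACf; have [d d0 Hd] := AC_continuous ACf ltr01.
pose P tau := exists M, forall t, 0 <= t <= tau -> normc (f t) <= M.
apply: (@real_induction P 1) => //.
  by exists (normc (f 0)) => t t0; have -> : t = 0 by apply/eqP; rewrite eq_le andbC.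
move=> x x01; exists d => // y z y0x xz1 xdy zxd [M HM].
exists (Num.max M (normc (f x) + 1)) => t /andP[t0 tz].
rewrite le_max; have [ty|yt] := leP t y; first by rewrite HM ?t0.
have t01 : 0 <= t <= 1 by rewrite t0 (le_trans tz)//; case/andP: xz1.
apply/orP; right; rewrite -[f t](subrK (f x)).
apply: le_trans (le_normcD _ _) _; rewrite addrC lerD2l.
apply/ltW/Hd => //; rewrite ltr_norml; apply/andP; split; lra.
Qed.

Lemma AC_Re f : AC f -> AC (fun t => (Re (f t))%:C).
Proof.
move=> ACf; apply: (AC_dominated (K := 1) ACf ACf) => a b _ _ _; rewrite mul1r.
rewrite -rmorphB -raddfB /= expr0n addr0 sqrtr_sqr.
by apply: le_trans (le_Re_normc _) _; rewrite lerDl normc_ge0.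
Qed.

Lemma AC_Im f : AC f -> AC (fun t => (Im (f t))%:C).
Proof.
move=> ACf; apply: (AC_dominated (K := 1) ACf ACf) => a b _ _ _; rewrite mul1r.
rewrite -rmorphB -raddfB /= expr0n addr0 sqrtr_sqr.
by apply: le_trans (le_Im_normc _) _; rewrite lerDl normc_ge0.
Qed.

Lemma AC_real_measurable (g : R -> R) : AC (fun t => (g t)%:C) -> measurable_fun I01 g.
Proof.
move=> ACg; apply: subspace_continuous_measurable_fun; first exact: measurable_itv.
apply/subspace_continuousP => x x01; apply/cvgrPdist_lt => e e0.
have [d d0 Hd] := AC_continuous ACg e0.
rewrite near_withinE; apply/nbhs_ballP; exists d => //= y xy y01.
have := Hd y x; rewrite -rmorphB /= expr0n addr0 sqrtr_sqr; apply => //.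
- by move: y01; rewrite /= in_itv/= => /andP[/ltW -> /ltW ->].
- by move: x01; rewrite /= in_itv/= => /andP[/ltW -> /ltW ->].
Qed.

Lemma AC_measurable f : AC f ->
  measurable_fun I01 (fun t => Re (f t)) /\ measurable_fun I01 (fun t => Im (f t)).
Proof.
by move=> ACf; split; apply: AC_real_measurable; [exact: AC_Re|exact: AC_Im].
Qed.

Lemma normc2E (z : R[i]) : normc2 z = normc z ^+ 2.
Proof. by rewrite normc_sqr. Qed.

Lemma integrable01_cst (c : R) : mu.-integrable I01 (EFin \o cst c).
Proof.
have I01_lty : (mu I01 < +oo)%E.
  by rewrite lebesgue_measure_itv /= lte_fin ltr01 oppr0 adde0 ltry.
apply: measurable_bounded_integrable => //.
by exists `|c|; split => // M cM x _; exact: ltW.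
Qed.

Lemma bounded_sqintegrable f (M : R) :
  measurable_fun I01 (fun t => Re (f t)) -> measurable_fun I01 (fun t => Im (f t)) ->
  (forall t, 0 < t < 1 -> normc (f t) <= M) -> sqintegrable f.
Proof.
move=> mr mi fM; split=> //.
have iM := integrable01_cst (M ^+ 2).
apply: le_integrable iM => //.
  apply/measurable_EFinP; apply: measurable_funD;
    exact: (measurableT_comp (exprn_measurable 2)).
move=> x x01 /=; rewrite lee_fin normc2E !ger0_norm ?sqr_ge0//.
have {}fx : normc (f x) <= M by apply: fM; move: x01; rewrite /= in_itv.
by rewrite lerXn2r ?nnegrE ?normc_ge0// (le_trans (normc_ge0 _) fx).
Qed.

Lemma AC_sqintegrable f : AC f -> sqintegrable f.
Proof.
move=> ACf; have [mr mi] := AC_measurable ACf; have [M HM] := AC_bounded ACf.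
by apply: (bounded_sqintegrable mr mi (M := M)) => t /andP[t0 t1]; rewrite HM ?ltW.
Qed.

(** * Primitives of square-integrable functions *)

Section Primitive.
Variable g : R -> R.
Hypothesis mg : measurable_fun I01 g.
Hypothesis ig2 : mu.-integrable I01 (EFin \o (fun x => g x ^+ 2)).

Let mI01 : measurable I01. Proof. exact: measurable_itv. Qed.

Lemma sqintegrable_integrable : mu.-integrable I01 (EFin \o g).
Proof.
have i1 : mu.-integrable I01 (fun x => (1%:E + (g x ^+ 2)%:E)%E).
  by apply: integrableD => //; exact: integrable01_cst.
apply: le_integrable i1 => //; first exact/measurable_EFinP.
move=> x _ /=; rewrite lee_fin [leRHS]ger0_norm ?addr_ge0 ?sqr_ge0//.
by rewrite ler_norml; apply/andP; split; nra.
Qed.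

Let gI := g \_ I01.

Let igI : mu.-integrable setT (EFin \o gI).
Proof. by rewrite /gI -restrict_EFin -integrable_mkcond//; exact: sqintegrable_integrable. Qed.

Let igID D : measurable D -> mu.-integrable D (EFin \o gI).
Proof. by move=> mD; exact: integrableS igI. Qed.

(** Extending [g] by 0 and integrating from -oo matches the form of Lebesgue's
    differentiation theorem on half-lines. *)
Definition primitive t := \int[mu]_(s in `]-oo, t]) gI s.

Lemma primitive0 : primitive 0 = 0.
Proof.
rewrite /primitive [RHS](_ : 0 = \int[mu]_(s in `]-oo, 0%R]) (0 : R)) //.
  apply: eq_Rintegral => s; rewrite inE /= in_itv /= => s0.
  rewrite /gI patchE memNset//= in_itv /=.
  by rewrite ltNge s0.
by rewrite Rintegral_cst// mul0r.
Qed.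

Lemma primitive1 : primitive 1 = \int[mu]_(s in I01) g s.
Proof.
rewrite /primitive [RHS]Rintegral_mkcond [LHS]Rintegral_mkcond.
apply: eq_Rintegral => s _; rewrite patchE; case: ifPn => // /negP s1.
rewrite patchE memNset// => s01; apply: s1; rewrite inE /=.
by move: s01; rewrite /= !in_itv /= => /andP[_ /ltW].
Qed.

Lemma primitiveB a b : a <= b ->
  primitive b - primitive a = \int[mu]_(s in `]a, b]) gI s.
Proof. by move=> ab; apply: Rintegral_itvB => //; exact: igID. Qed.

Lemma primitive_derive :
  {ae mu, forall x : R, 0 < x < 1 -> is_derive x (1 : R) primitive (g x)}.
Proof.
have : {ae mu, forall x, derivable primitive x 1 /\ primitive^`()%classic x = gI x}.
  apply: FTC1Ny; first by move=> y; exact: igID.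
  by apply: integrable_locally => //; exact: sqintegrable_integrable.
apply: (@filterS _ _ ae_lebesgue_filter) => x [dp px] x01; split=> //.
by rewrite -derive1E px /gI patchE mem_set//= in_itv.
Qed.

Lemma primitive_bounded t : `|primitive t| <= \int[mu]_(s in I01) `|g s|.
Proof.
apply: le_trans (le_normr_Rintegral _ _) _ => //; first exact: igID.
rewrite [leRHS]Rintegral_mkcond [leLHS]Rintegral_mkcond.
apply: le_Rintegral => //.
- have := @igID `]-oo, t] (measurable_itv _).
  by move=> /integrable_norm; rewrite integrable_mkcond// restrict_EFin.
- have /integrable_norm := sqintegrable_integrable.
  by rewrite integrable_mkcond// restrict_EFin.
- move=> x _; rewrite /gI !patchE; do 2 case: ifP => //.
    by rewrite normr0.
  by move=> _ _; exact: normr_ge0.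
Qed.

(** [|g| <= N + g^2 / N], so the variation of the primitive over intervals of
    total length [l] is at most [N l + S / N], where [S] is the integral of [g^2]:
    choose first [N] large, then [l] small. *)
Lemma primitive_AC : AC (fun t => (primitive t)%:C).
Proof.
move=> e e0; pose S := \int[mu]_(x in I01) (g x ^+ 2).
have S0 : 0 <= S by apply: Rintegral_ge0 => x _; exact: sqr_ge0.
pose c := e / 2 / (S + 1); have c0 : 0 < c by rewrite !divr_gt0// ltr_wpDl.
have cS : c * S < e / 2.
  by rewrite /c mulrAC ltr_pdivrMr ?ltr_wpDl// ltr_pM2l ?divr_gt0// ltrDl.
exists (c * (e / 2)) => [|s s01 nos lens]; first by rewrite mulr_gt0// divr_gt0.
pose phi := fun x => (c * gI x ^+ 2)%:E.
have mgI : measurable_fun setT gI by apply/measurable_EFinP; exact: measurable_int igI.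
have mphi : measurable_fun setT phi.
  apply/measurable_EFinP; apply: measurable_funM; first exact: measurable_cst.
  exact: (measurableT_comp (exprn_measurable 2)).
have phi0 x : (0 <= phi x)%E by rewrite lee_fin mulr_ge0 ?sqr_ge0// ltW.
have intphi : (\int[mu]_x phi x = (c * S)%:E)%E.
  rewrite [LHS](_ : _ = \int[mu]_x ((fun y => (c%:E * (g y ^+ 2)%:E)%E) \_ I01) x)%E.
    rewrite -integral_mkcond integralZl// [RHS]EFinM; congr (_ * _)%E.
    by rewrite fineK// integrable_fin_num.
  apply: eq_integral => x _; rewrite /phi /gI !patchE.
  by case: ifP => _; [rewrite EFinM|rewrite [X in X ^+ 2](_ : _ = 0)// expr0n mulr0].
have bd p : p.1 <= p.2 -> ((normc ((primitive p.2)%:C - (primitive p.1)%:C))%:E <=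
    (c^-1 * (p.2 - p.1))%:E + \int[mu]_(x in `]p.1, p.2]) phi x)%E.
  move=> p12; have mp : measurable (`]p.1, p.2]%classic : set R) by exact: measurable_itv.
  rewrite -rmorphB /= expr0n addr0 sqrtr_sqr primitiveB// EFin_normr_Rintegral//; last exact: igID.
  have mEgI : measurable_fun `]p.1, p.2] (EFin \o gI).
    by apply: (measurable_int mu); exact: igID.
  apply: le_trans (le_abse_integral _ _ _) _ => //.
  have -> : ((c^-1 * (p.2 - p.1))%:E = \int[mu]_(x in `]p.1, p.2]) (cst c^-1%:E) x)%E.
    rewrite integral_cst// [X in (_ * X)%E](_ : _ = (p.2 - p.1)%:E)//.
    rewrite [LHS]lebesgue_measure_itv /= lte_fin; case: ltP => // p21.
    by congr EFin; apply/eqP; rewrite eq_le subr_ge0 p12 subr_le0 p21.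
  rewrite -ge0_integralD//; last 2 first.
  - by move=> x _; rewrite lee_fin invr_ge0 ltW.
  - exact: measurable_funTS.
  apply: ge0_le_integral => //.
  - exact: measurableT_comp.
  - by apply: emeasurable_funD => //; exact: measurable_funTS.
  - move=> x _; rewrite -EFinD lee_fin.
    have cV : c * c^-1 = 1 by rewrite mulfV// gt_eqF.
    have cV0 : 0 < c^-1 by rewrite invr_gt0.
    rewrite -(@ler_pM2l _ c)// mulrDr cV mulrA.
    rewrite -[X in X * `|_|](ger0_norm (ltW c0)) -normrM -expr2 -exprMn.
    move: (c * gI x) => y; rewrite ler_norml; apply/andP; split; nra.
rewrite -lte_fin -sumEFin.
apply: (@le_lt_trans _ _ (\sum_(p <- s)
    ((c^-1 * (p.2 - p.1))%:E + \int[mu]_(x in `]p.1, p.2]) phi x))%E).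
  rewrite big_seq [leRHS]big_seq; apply: lee_sum => p /s01/and3P[_ p12 _].
  exact: bd.
rewrite big_split /= sumEFin -mulr_sumr.
have Hs : (\sum_(p <- s) \int[mu]_(x in `]p.1, p.2]) phi x <= (c * S)%:E)%E.
  by rewrite -intphi; apply: sum_integral_nonoverlapping.
apply: le_lt_trans (leeD2l _ Hs) _.
rewrite -EFinD lte_fin [ltRHS]splitr ltrD// mulrC ltr_pdivrMr//.
by rewrite mulrC.
Qed.

End Primitive.

End AbsoluteContinuity.

(** * The fundamental theorem of calculus *)

Section ComplexDerivative.
Context {R : realType}.
Local Notation mu := (@lebesgue_measure R).
Local Notation I01 := (`]0%R, 1%R[%classic : set R).
Local Notation AC := (absolutely_continuous 0 1).
Implicit Types (f g h k l : R -> R[i]).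

Lemma is_cderive_cst (c : R[i]) x : is_cderive (fun _ : R => c) x 0.
Proof. by split; exact: is_derive_cst. Qed.

Lemma is_cderiveD f g x a b : is_cderive f x a -> is_cderive g x b ->
  is_cderive (fun t => f t + g t) x (a + b).
Proof.
move=> [f1 f2] [g1 g2]; split.
  have -> : (fun t => Re (f t + g t)) = (fun t => Re (f t)) + (fun t => Re (g t)).
    by apply/funext => t; exact: raddfD.
  by case: a b f1 f2 g1 g2 => [? ?] [? ?] /= *; exact: is_deriveD.
have -> : (fun t => Im (f t + g t)) = (fun t => Im (f t)) + (fun t => Im (g t)).
  by apply/funext => t; exact: raddfD.
by case: a b f1 f2 g1 g2 => [? ?] [? ?] /= *; exact: is_deriveD.
Qed.

Lemma is_cderiveM f g x a b : is_cderive f x a -> is_cderive g x b ->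
  is_cderive (fun t => f t * g t) x (a * g x + f x * b).
Proof.
move=> [f1 f2] [g1 g2]; split.
  have -> : (fun t => Re (f t * g t)) =
      (fun t => Re (f t)) * (fun t => Re (g t)) - (fun t => Im (f t)) * (fun t => Im (g t)).
    apply/funext => t; rewrite [RHS](_ : _ = Re (f t) * Re (g t) - Im (f t) * Im (g t))//.
    by case: (f t) (g t) => [? ?] [? ?].
  apply: is_derive_eq.
  case: (f x) (g x) a b {f1 f2 g1 g2} => [u1 u2] [v1 v2] [a1 a2] [b1 b2];
    by rewrite /= /GRing.scale /=; ring.
have -> : (fun t => Im (f t * g t)) =
    (fun t => Re (f t)) * (fun t => Im (g t)) + (fun t => Im (f t)) * (fun t => Re (g t)).
  apply/funext => t; rewrite [RHS](_ : _ = Re (f t) * Im (g t) + Im (f t) * Re (g t))//.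
  by case: (f t) (g t) => [? ?] [? ?].
apply: is_derive_eq.
case: (f x) (g x) a b {f1 f2 g1 g2} => [u1 u2] [v1 v2] [a1 a2] [b1 b2];
    by rewrite /= /GRing.scale /=; ring.
Qed.

Lemma is_cderive_conj f x a : is_cderive f x a ->
  is_cderive (fun t => conjc (f t)) x (conjc a).
Proof.
move=> [f1 f2]; split.
  have -> : (fun t => Re (conjc (f t))) = (fun t => Re (f t)).
    by apply/funext => t; case: (f t).
  by case: a f1 {f2} => ? ? f1; exact: f1.
have -> : (fun t => Im (conjc (f t))) = - (fun t => Im (f t)).
  by apply/funext => t; rewrite [RHS](_ : _ = - Im (f t))//; case: (f t).
have -> : Im (conjc a) = - Im a by case: a {f1 f2}.
exact: is_deriveN.
Qed.

(** Absolute continuity is part of the notion: without it, as Cantor's function shows,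
    an almost everywhere derivative does not determine the function up to a
    constant. *)
Definition ae_derivative f k : Prop :=
  AC f /\ {ae mu, forall x : R, 0 < x < 1 -> is_cderive f x (k x)}.

Lemma eq_ae_derivative f k l : (forall t, k t = l t) ->
  ae_derivative f k -> ae_derivative f l.
Proof. by move=> /funext ->. Qed.

Lemma ae_derivative_cst (c : R[i]) : ae_derivative (fun _ => c) (fun _ => 0).
Proof. by split; [exact: AC_cst|apply: aeW => x _; exact: is_cderive_cst]. Qed.

Lemma ae_derivativeD f g k l : ae_derivative f k -> ae_derivative g l ->
  ae_derivative (fun t => f t + g t) (fun t => k t + l t).
Proof.
move=> [ACf fk] [ACg gl]; split.
  apply: (AC_dominated (K := 1) ACf ACg) => a b _ _ _; rewrite mul1r.
  by rewrite opprD addrACA le_normcD.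
move: fk gl; apply: filterS2 => x fk gl x01.
by apply: is_cderiveD; [exact: fk|exact: gl].
Qed.

Lemma ae_derivative_conj f k : ae_derivative f k ->
  ae_derivative (fun t => conjc (f t)) (fun t => conjc (k t)).
Proof.
move=> [ACf fk]; split.
  apply: (AC_dominated (K := 1) ACf ACf) => a b _ _ _; rewrite mul1r.
  by rewrite -rmorphB normc_conj lerDl normc_ge0.
by move: fk; apply: filterS => x fk x01; apply: is_cderive_conj; exact: fk.
Qed.

Lemma ae_derivativeM f g k l : ae_derivative f k -> ae_derivative g l ->
  ae_derivative (fun t => f t * g t) (fun t => k t * g t + f t * l t).
Proof.
move=> [ACf fk] [ACg gl]; split.
  have [M HM] := AC_bounded ACf; have [N HN] := AC_bounded ACg.
  apply: (AC_dominated (K := `|M| + `|N|) ACf ACg) => a b a0 ab b1.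
  have -> : f b * g b - f a * g a = (f b - f a) * g b + f a * (g b - g a) by ring.
  apply: le_trans (le_normcD _ _) _; rewrite !Normc.normcM.
  have fa : normc (f a) <= `|M|.
    by apply: le_trans (ler_norm _); apply: HM; rewrite a0 (le_trans ab).
  have gb : normc (g b) <= `|N|.
    by apply: le_trans (ler_norm _); apply: HN; rewrite b1 (le_trans a0).
  have := (normc_ge0 (f b - f a), normc_ge0 (g b - g a), normc_ge0 (f a), normc_ge0 (g b)).
  by move=> [[[? ?] ?] ?]; nra.
move: fk gl; apply: filterS2 => x fk gl x01.
by apply: is_cderiveM; [exact: fk|exact: gl].
Qed.

Lemma ae_derivativeZ (c : R[i]) f k : ae_derivative f k ->
  ae_derivative (fun t => c * f t) (fun t => c * k t).
Proof.
move=> /(ae_derivativeM (ae_derivative_cst c)).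
by apply: eq_ae_derivative => t; rewrite mul0r add0r.
Qed.

Lemma ae_derivativeB f g k l : ae_derivative f k -> ae_derivative g l ->
  ae_derivative (fun t => f t - g t) (fun t => k t - l t).
Proof.
move=> fk /(ae_derivativeZ (-1)) /(ae_derivativeD fk) [AC' fk'].
split; first by move: AC'; congr (AC _); apply/funext => t; rewrite mulN1r.
move: fk'; apply: filterS => x H /H.
rewrite mulN1r (_ : (fun t => f t - g t) = (fun t => f t + -1 * g t))//.
by apply/funext => t; rewrite mulN1r.
Qed.

Lemma ae_derivative_ae f k l : ae_derivative f k ->
  {ae mu, forall x : R, 0 < x < 1 -> k x = l x} -> ae_derivative f l.
Proof.
move=> [ACf fk] kl; split=> //; move: fk kl; apply: filterS2 => x fk kl x01.
by rewrite -kl//; exact: fk.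
Qed.

Lemma sqintegrable_Re k : sqintegrable k ->
  mu.-integrable I01 (EFin \o (fun x => Re (k x) ^+ 2)).
Proof.
move=> [mr mi i2]; apply: le_integrable i2 => //.
  by apply/measurable_EFinP; exact: (measurableT_comp (exprn_measurable 2)).
move=> x _ /=; rewrite lee_fin !ger0_norm ?sqr_ge0 ?addr_ge0 ?sqr_ge0//.
by rewrite /normc2 lerDl sqr_ge0.
Qed.

Lemma sqintegrable_Im k : sqintegrable k ->
  mu.-integrable I01 (EFin \o (fun x => Im (k x) ^+ 2)).
Proof.
move=> [mr mi i2]; apply: le_integrable i2 => //.
  by apply/measurable_EFinP; exact: (measurableT_comp (exprn_measurable 2)).
move=> x _ /=; rewrite lee_fin !ger0_norm ?sqr_ge0 ?addr_ge0 ?sqr_ge0//.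
by rewrite /normc2 lerDr sqr_ge0.
Qed.

(** The bound by the L^1 norm is what makes the solution operators of differential
    equations bounded on L^2. *)
Lemma exists_primitive k : sqintegrable k ->
  exists P, [/\ ae_derivative P k, P 0 = 0, P 1 = cintegral k &
    forall t, normc (P t) <=
      \int[mu]_(x in I01) `|Re (k x)| + \int[mu]_(x in I01) `|Im (k x)|].
Proof.
move=> k2; have [mr mi _] := k2.
have ir := sqintegrable_Re k2; have ii := sqintegrable_Im k2.
pose r := primitive (fun x => Re (k x)); pose i := primitive (fun x => Im (k x)).
have ACr : AC (fun t => (r t)%:C) by exact: primitive_AC.
have ACi : AC (fun t => (i t)%:C) by exact: primitive_AC.
exists (fun t => r t +i* i t); split.
- split.
    apply: (AC_dominated (K := 1) ACr ACi) => a b _ _ _; rewrite mul1r.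
    rewrite -!rmorphB !normc_real.
    exact: normc_le_ReIm.
  have := primitive_derive mi ii; have := primitive_derive mr ir.
  by apply: filterS2 => x dr di x01; split; [exact: dr|exact: di].
- by rewrite /r /i !primitive0.
- by rewrite /r /i !primitive1.
- move=> t; apply: le_trans (normc_le_ReIm _) _; rewrite lerD//=.
    exact: primitive_bounded.
  exact: primitive_bounded.
Qed.

(** The difference of [f] and a primitive of [k] has derivative 0 almost everywhere,
    so it is constant. *)
Lemma ae_derivative_FTC f k : ae_derivative f k -> sqintegrable k ->
  cintegral k = f 1 - f 0.
Proof.
move=> fk /exists_primitive[P [Pk P0 <- _]].
have [AC' d0] := ae_derivativeB fk Pk.
have := AC_derive0_cst AC' _ (t := 1); rewrite ler01 lexx P0 subr0 => <- //.
  by rewrite opprB addrC subrK.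
by move: d0; apply: filterS => x /[apply]; rewrite subrr.
Qed.

End ComplexDerivative.

(** * Square-integrable functions and their classes *)

Section L2Classes.
Context {R : realType}.
Local Notation mu := (@lebesgue_measure R).
Local Notation I01 := (`]0%R, 1%R[%classic : set R).
Local Notation AC := (absolutely_continuous 0 1).
Implicit Types (f g h k l : R -> R[i]).

(** Functions that are not square-integrable are sent to 0, so that integrability is a
    side condition of the lemmas rather than part of the data. *)
Definition L2of f : L2 R := L2class (insubd (0 : L2fun R) f).

Lemma insubd_sqintegrable f : sqintegrable f ->
  (insubd (0 : L2fun R) f : R -> R[i]) = f.
Proof. by move=> f2; apply: insubdK; apply/asboolP. Qed.

Lemma L2of_val (F : L2fun R) : L2of F = L2class F.
Proof. by rewrite /L2of valKd. Qed.

Lemma L2of_repr (x : L2 R) : exists2 f, sqintegrable f & x = L2of f.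
Proof.
exists (repr x : L2fun R); first exact: L2funP.
by rewrite L2of_val reprL2K.
Qed.

Lemma sqint_predE f : (f \in @sqint_pred R) <-> sqintegrable f.
Proof. by split => [/asboolP|f2]; [|exact/asboolP]. Qed.

Lemma sqintegrableD f g : sqintegrable f -> sqintegrable g ->
  sqintegrable (fun t => f t + g t).
Proof.
move=> f2 g2; have [_ H] := @sqintegrable_submod R.
have /sqint_predE := H 1 f g (proj2 (sqint_predE f) f2) (proj2 (sqint_predE g) g2).
by rewrite scale1r.
Qed.

Lemma sqintegrableZ (c : R[i]) f : sqintegrable f -> sqintegrable (fun t => c * f t).
Proof.
move=> f2; have [H0 H] := @sqintegrable_submod R.
have /sqint_predE := H c f 0 (proj2 (sqint_predE f) f2) H0.
by rewrite addr0.
Qed.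

Lemma sqintegrableB f g : sqintegrable f -> sqintegrable g ->
  sqintegrable (fun t => f t - g t).
Proof.
move=> f2 /(sqintegrableZ (-1)) /(sqintegrableD f2).
by congr sqintegrable; apply/funext => t; rewrite mulN1r.
Qed.

Lemma sqintegrable_conj f : sqintegrable f -> sqintegrable (fun t => conjc (f t)).
Proof.
move=> [mr mi i2]; split.
- by move: mr; congr measurable_fun; apply/funext => t; case: (f t).
- have := measurable_funN mi.
  by congr measurable_fun; apply/funext => t; rewrite /=; case: (f t).
- move: i2; congr (_.-integrable _ _); apply/funext => t; congr EFin.
  by rewrite /normc2; case: (f t) => a b /=; rewrite sqrrN.
Qed.

Lemma AC_sqintegrableM f k : AC f -> sqintegrable k ->
  sqintegrable (fun t => f t * k t).
Proof.
move=> ACf [kr ki k2]; have [fr fi] := AC_measurable ACf; have [M HM] := AC_bounded ACf.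
have mr : measurable_fun I01 (fun t => Re (f t * k t)).
  have -> : (fun t => Re (f t * k t)) = (fun t => Re (f t) * Re (k t) - Im (f t) * Im (k t)).
    by apply/funext => t; case: (f t) (k t) => [? ?] [? ?].
  by apply: measurable_funB; exact: measurable_funM.
have mi : measurable_fun I01 (fun t => Im (f t * k t)).
  have -> : (fun t => Im (f t * k t)) = (fun t => Re (f t) * Im (k t) + Im (f t) * Re (k t)).
    by apply/funext => t; case: (f t) (k t) => [? ?] [? ?].
  by apply: measurable_funD; exact: measurable_funM.
split=> //.
have iM : mu.-integrable I01 (fun x => ((M ^+ 2)%:E * (normc2 (k x))%:E)%E).
  exact: integrableZl.
apply: le_integrable iM => //.
  apply/measurable_EFinP; apply: measurable_funD;
    exact: (measurableT_comp (exprn_measurable 2)).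
move=> x x01; rewrite -EFinM lee_fin !normc2E Normc.normcM exprMn.
rewrite [leLHS]ger0_norm; last by rewrite mulr_ge0 ?sqr_ge0.
rewrite [leRHS]ger0_norm; last by rewrite mulr_ge0 ?sqr_ge0.
rewrite ler_wpM2r ?sqr_ge0//.
have {}HM : normc (f x) <= M.
  by apply: HM; move: x01; rewrite /= in_itv /= => /andP[/ltW -> /ltW ->].
by rewrite lerXn2r ?nnegrE ?normc_ge0// (le_trans (normc_ge0 _) HM).
Qed.

Lemma L2ofD f g : sqintegrable f -> sqintegrable g ->
  L2of (fun t => f t + g t) = L2of f + L2of g.
Proof.
move=> f2 g2; rewrite -[RHS]L2classD; apply/L2classP; apply: aeW => x _.
rewrite [in LHS]insubd_sqintegrable; last exact: sqintegrableD.
rewrite [RHS](_ : _ = (insubd (0 : L2fun R) f : R -> R[i]) x +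
  (insubd (0 : L2fun R) g : R -> R[i]) x)//.
by rewrite !insubd_sqintegrable.
Qed.

Lemma L2ofZ (c : R[i]) f : sqintegrable f -> L2of (fun t => c * f t) = c *: L2of f.
Proof.
move=> f2; rewrite -[RHS]L2classZ; apply/L2classP; apply: aeW => x _.
rewrite [in LHS]insubd_sqintegrable; last exact: sqintegrableZ.
rewrite [RHS](_ : _ = c * (insubd (0 : L2fun R) f : R -> R[i]) x)//.
by rewrite insubd_sqintegrable.
Qed.

Lemma L2ofB f g : sqintegrable f -> sqintegrable g ->
  L2of (fun t => f t - g t) = L2of f - L2of g.
Proof.
move=> f2 g2; rewrite -[- L2of g]scaleN1r -L2ofZ// -L2ofD//; last exact: sqintegrableZ.
by congr L2of; apply/funext => t; rewrite mulN1r.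
Qed.

Lemma L2of0 : L2of (fun _ => 0) = 0.
Proof.
rewrite (_ : (fun _ => 0) = (fun t : R => 0 * (0 : R[i]))).
  by rewrite L2ofZ ?scale0r//; exact: AC_sqintegrable (AC_cst 0).
by apply/funext => t; rewrite mulr0.
Qed.

Lemma L2of_eqP f g : sqintegrable f -> sqintegrable g ->
  L2of f = L2of g <-> {ae mu, forall x : R, 0 < x < 1 -> f x = g x}.
Proof.
by move=> f2 g2; rewrite L2classP !insubd_sqintegrable.
Qed.

Lemma inner_L2of f g : sqintegrable f -> sqintegrable g ->
  inner (L2of f) (L2of g) = cintegral (fun t => f t * conjc (g t)).
Proof.
move=> f2 g2; rewrite [LHS](L2innerE _ _); congr cintegral; apply/funext => t.
by rewrite !insubd_sqintegrable.
Qed.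

Lemma hnorm_sqr_L2of f : sqintegrable f ->
  hnorm (L2of f) ^+ 2 = \int[mu]_(x in I01) normc2 (f x).
Proof.
move=> f2; rewrite hnorm_sqr inner_L2of// /cintegral; apply: eq_Rintegral => t _.
by rewrite mulcJ normc2E.
Qed.

Lemma sqintegrable_normc2 f : sqintegrable f ->
  mu.-integrable I01 (EFin \o (fun t => normc2 (f t))).
Proof. by case. Qed.

Lemma le_hnorm_L2of f g : sqintegrable f -> sqintegrable g ->
  (forall t, 0 < t < 1 -> normc (f t) <= normc (g t)) ->
  hnorm (L2of f) <= hnorm (L2of g).
Proof.
move=> f2 g2 fg; rewrite -(@ler_pXn2r _ 2)// ?nnegrE ?hnorm_ge0//.
rewrite !hnorm_sqr_L2of//; apply: le_Rintegral => //.
- exact: sqintegrable_normc2.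
- exact: sqintegrable_normc2.
- by move=> x x01; rewrite !normc2E lerXn2r ?nnegrE ?normc_ge0// fg.
Qed.

Lemma hnorm_L2of_cst (c : R[i]) : hnorm (L2of (fun _ => c)) = normc c.
Proof.
have c2 := AC_sqintegrable (AC_cst c).
apply/eqP; rewrite -(@eqrXn2 _ 2)// ?hnorm_ge0 ?normc_ge0//.
rewrite hnorm_sqr_L2of// Rintegral_cst// normc2E.
rewrite [fine _](_ : _ = 1) ?mulr1//.
rewrite [X in fine X](_ : _ = 1%E)// [LHS]lebesgue_measure_itv /= lte_fin ltr01.
by rewrite oppr0 adde0.
Qed.

Lemma hnorm_L2of_le f (M : R) : sqintegrable f ->
  (forall t, 0 < t < 1 -> normc (f t) <= M) -> hnorm (L2of f) <= `|M|.
Proof.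
move=> f2 fM; rewrite -normc_real -hnorm_L2of_cst; apply: le_hnorm_L2of => //.
  exact: AC_sqintegrable (AC_cst _).
by move=> t t01; rewrite normc_real (le_trans (fM t t01))// ler_norm.
Qed.

(** Cauchy-Schwarz inequality against the constant function 1. *)
Lemma integral_norm_le_hnorm (r : R -> R) k : sqintegrable k -> measurable_fun I01 r ->
  (forall t, `|r t| <= normc (k t)) ->
  \int[mu]_(x in I01) `|r x| <= hnorm (L2of k).
Proof.
move=> k2 mr rk; pose f := fun t => (`|r t|)%:C.
have f2 : sqintegrable f.
  have mf : measurable_fun I01 (fun t => `|r t|) by exact: measurableT_comp.
  have mi : measurable_fun I01 (fun t => Im (f t)) by rewrite /f /=; exact: measurable_cst.
  split; [exact: mf|exact: mi|].
  apply: le_integrable (sqintegrable_normc2 k2) => //.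
    by apply/measurable_EFinP; apply: measurable_funD;
      exact: (measurableT_comp (exprn_measurable 2)).
  move=> x _; rewrite lee_fin !normc2E /f normc_real normr_id.
  rewrite [leLHS]ger0_norm ?sqr_ge0// [leRHS]ger0_norm ?sqr_ge0//.
  by rewrite lerXn2r ?nnegrE ?normc_ge0.
have o2 := AC_sqintegrable (AC_cst (1 : R[i])).
have := cauchy_schwarz (L2of f) (L2of (fun _ => 1)).
rewrite hnorm_L2of_cst Normc.normc1 mulr1 inner_L2of//.
rewrite (_ : cintegral _ = (\int[mu]_(x in I01) `|r x|)%:C); last first.
  congr (_ +i* _).
    by apply: eq_Rintegral => x _ /=; rewrite oppr0 !mulr0 mulr1 subr0.
  transitivity (\int[mu]_(x in I01) (0 : R)); last by rewrite Rintegral_cst// mul0r.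
  by apply: eq_Rintegral => x _ /=; rewrite oppr0 !(mulr0, mul0r) addr0.
rewrite normc_real => h; apply: le_trans (ler_norm _) _; apply: le_trans h _.
by apply: le_hnorm_L2of => // t _; rewrite normc_real normr_id.
Qed.

Lemma integral_ReIm_le_hnorm k : sqintegrable k ->
  \int[mu]_(x in I01) `|Re (k x)| + \int[mu]_(x in I01) `|Im (k x)| <=
  2 * hnorm (L2of k).
Proof.
move=> k2; have [mr mi _] := k2; rewrite mulrDl mul1r lerD//.
  by apply: integral_norm_le_hnorm => // t; exact: le_Re_normc.
by apply: integral_norm_le_hnorm => // t; exact: le_Im_normc.
Qed.

(** The fundamental theorem of calculus for [f * conjc g]. *)
Lemma integration_by_parts_L2 f g k l :
  ae_derivative f k -> ae_derivative g l -> sqintegrable k -> sqintegrable l ->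
  inner (L2of k) (L2of g) + inner (L2of f) (L2of l) =
  f 1 * conjc (g 1) - f 0 * conjc (g 0).
Proof.
move=> fk gl k2 l2; have gJ := ae_derivative_conj gl.
have h1 : sqintegrable (fun t => k t * conjc (g t)).
  have := AC_sqintegrableM gJ.1 k2.
  by congr sqintegrable; apply/funext => t; rewrite mulrC.
have h2 : sqintegrable (fun t => f t * conjc (l t)).
  by apply: (AC_sqintegrableM fk.1); exact: sqintegrable_conj.
rewrite -(ae_derivative_FTC (ae_derivativeM fk gJ) (sqintegrableD h1 h2)).
have f2 := AC_sqintegrable fk.1; have g2 := AC_sqintegrable gl.1.
have c1 h : sqintegrable h -> cintegral h = inner (L2of h) (L2of (fun _ => 1)).
  move=> hs; rewrite inner_L2of//; last exact: AC_sqintegrable (AC_cst 1).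
  by congr cintegral; apply/funext => t; rewrite rmorph1 mulr1.
by rewrite !inner_L2of// !c1//; [rewrite L2ofD// innerDl|exact: sqintegrableD].
Qed.

Lemma T0E (x y : L2 R) : T0 R x y <-> exists f k,
  [/\ ae_derivative f k, sqintegrable k, f 0 = 0 /\ f 1 = 0, x = L2of f & y = L2of k].
Proof.
split.
  move=> [F [[-> AC' [K -> FK]] F0 F1]]; exists F, K; split => //.
  - exact: L2funP.
  - by rewrite L2of_val.
  - by rewrite L2of_val.
move=> [f [k [fk k2 [f0 f1] -> ->]]]; exists (insubd (0 : L2fun R) f).
have f2 := AC_sqintegrable fk.1; case: fk => fk1 fk2.
rewrite /ac_derivative insubd_sqintegrable//; split=> //; split=> //.
by exists (insubd (0 : L2fun R) k) => //; rewrite insubd_sqintegrable.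
Qed.

Lemma T0_starE (x y : L2 R) : T0_star R x y <-> exists f k,
  [/\ ae_derivative f k, sqintegrable k, x = L2of f & y = - L2of k].
Proof.
split.
  move=> [F [-> AC' [K yK FK]]]; exists F, K; split => //.
  - exact: L2funP.
  - by rewrite L2of_val.
  - by rewrite L2of_val -yK opprK.
move=> [f [k [fk k2 -> ->]]]; exists (insubd (0 : L2fun R) f).
have f2 := AC_sqintegrable fk.1; case: fk => fk1 fk2.
rewrite /ac_derivative insubd_sqintegrable// opprK; split=> //.
by exists (insubd (0 : L2fun R) k) => //; rewrite insubd_sqintegrable.
Qed.

End L2Classes.

(** * The adjoints of differentiation *)

Section AdjointOfDerivative.
Context {R : realType}.
Implicit Types (f g h k l : R -> R[i]) (x y z w : L2 R).

Let one2 : sqintegrable (fun _ : R => 1 : R[i]).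
Proof. exact: AC_sqintegrable (AC_cst 1). Qed.

Lemma cintegralE h : sqintegrable h -> cintegral h = inner (L2of h) (L2of (fun _ => 1)).
Proof.
move=> hs; rewrite inner_L2of//.
by congr cintegral; apply/funext => t; rewrite rmorph1 mulr1.
Qed.

Lemma T0_star_adjoint y z : T0_star R y z -> adjoint (T0 R) y z.
Proof.
move=> /T0_starE[f [k [fk k2 -> ->]]] _ _ /T0E[g [l [gl l2 [g0 g1] -> ->]]].
have := integration_by_parts_L2 gl fk l2 k2.
by rewrite g0 g1 !mul0r subrr innerNr => /eqP; rewrite addr_eq0 => /eqP.
Qed.

(** If [<g', y> = <g, z>] for all test functions [g] and [Z] is a primitive of [z],
    then [<g', y + Z> = 0]. The derivatives [g'] of test functions are the functions
    of mean zero, so choosing [g' = y + Z - c], with [c] the mean of [y + Z], shows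
    that [y + Z] is constant. *)
Lemma adjoint_T0 : adjoint (T0 R) = T0_star R.
Proof.
apply: opP => y z; split; last exact: T0_star_adjoint.
have [y0 y02 ->] := L2of_repr y; have [z0 z02 ->] := L2of_repr z => yz.
have [Z [Zz Z0 _ _]] := exists_primitive z02; have Z2 := AC_sqintegrable Zz.1.
pose c := cintegral (fun t => y0 t + Z t).
have c2 : sqintegrable (fun _ : R => c) by exact: AC_sqintegrable (AC_cst _).
have yZ2 := sqintegrableD y02 Z2.
pose W t := y0 t + Z t - c.
have W2 : sqintegrable W by exact: sqintegrableB.
have WE : L2of W = L2of (fun t => y0 t + Z t) - L2of (fun _ => c) by exact: L2ofB.
have cE : L2of (fun _ : R => c) = c *: L2of (fun _ => 1).
  by rewrite -L2ofZ//; congr L2of; apply/funext => t; rewrite mulr1.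
have W1 : inner (L2of W) (L2of (fun _ => 1)) = 0.
  rewrite WE innerBl -cintegralE// cE innerZl inner_hnorm hnorm_L2of_cst.
  by rewrite Normc.normc1 expr1n mulr1 subrr.
have [G [GW G0 G1 _]] := exists_primitive W2.
rewrite cintegralE// W1 in G1.
have WyZ : inner (L2of W) (L2of (fun t => y0 t + Z t)) = 0.
  rewrite L2ofD// innerDr (yz (L2of G) (L2of W)); last by apply/T0E; exists G, W.
  rewrite addrC (integration_by_parts_L2 GW Zz W2 z02).
  by rewrite G0 G1 !mul0r subrr.
have W0 : L2of W = 0.
  apply: inner_eq0; rewrite [X in inner _ X]WE innerBr WyZ cE innerZr W1.
  by rewrite mulr0 subrr.
apply/T0_starE; exists (fun t => c - Z t), (fun t => 0 - z0 t); split.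
- exact: ae_derivativeB (ae_derivative_cst _) Zz.
- by apply: sqintegrableB => //; exact: AC_sqintegrable (AC_cst _).
- move: W0; rewrite WE L2ofD// L2ofB// => /eqP; rewrite subr_eq0 => /eqP <-.
  by rewrite addrK.
- by rewrite L2ofB ?L2of0 ?sub0r ?opprK//; exact: AC_sqintegrable (AC_cst _).
Qed.

Lemma ae_derivative_id : ae_derivative (fun t : R => t%:C) (fun _ => 1).
Proof.
split; first exact: AC_id.
by apply: aeW => x _; split; [exact: is_derive_id|exact: is_derive_cst].
Qed.

(** By restriction to the domain of [T0], an element of the adjoint is again absolutely
    continuous; testing against the
    constant function 1 and the identity forces the boundary values to vanish. *)
Lemma adjoint_T0_star : adjoint (T0_star R) = T0 R.
Proof.
apply: opP => y z; split; last first.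
  move=> yz a b /T0_star_adjoint /(_ _ _ yz) E.
  by rewrite [LHS]inner_conjc [RHS]inner_conjc E.
move=> yz; have : T0_star R y (- z).
  rewrite -adjoint_T0 => a b /T0E[f [k [fk k2 _ -> ->]]].
  have /yz : T0_star R (L2of f) (- L2of k) by apply/T0_starE; exists f, k.
  by rewrite innerNl innerNr => <-; rewrite opprK.
move=> /T0_starE[f [k [fk k2 yE /oppr_inj zE]]].
have bd g l : ae_derivative g l -> sqintegrable l ->
    g 1 * conjc (f 1) = g 0 * conjc (f 0).
  move=> gl l2; apply/eqP; rewrite -subr_eq0; apply/eqP.
  rewrite -(integration_by_parts_L2 gl fk l2 k2) -yE -zE.
  have /yz : T0_star R (L2of g) (- L2of l) by apply/T0_starE; exists g, l.
  by rewrite innerNl => <-; rewrite subrr.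
have f1 : f 1 = 0.
  have := bd _ _ ae_derivative_id one2.
  by rewrite rmorph1 mul1r rmorph0 mul0r => /eqP; rewrite conjc_eq0 => /eqP.
have f0 : f 0 = 0.
  have := bd _ _ (ae_derivative_cst 1) (AC_sqintegrable (AC_cst 0)).
  by rewrite !mul1r f1 conjc0 => /esym/eqP; rewrite conjc_eq0 => /eqP.
by apply/T0E; exists f, k.
Qed.

End AdjointOfDerivative.

(** * Density of the domain of differentiation *)

Section Density.
Context {R : realType}.
Local Notation mu := (@lebesgue_measure R).
Local Notation I01 := (`]0%R, 1%R[%classic : set R).
Implicit Types (f g h k l : R -> R[i]) (a b c : R -> R) (x y z : L2 R).

(** The space [H^1(0, 1)], each class being given by its continuous representative. *)
Definition sobolev f : Prop := exists2 k, ae_derivative f k & sqintegrable k.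

Lemma sobolevM f g : sobolev f -> sobolev g -> sobolev (fun t => f t * g t).
Proof.
move=> [k fk k2] [l gl l2]; eexists; first exact: ae_derivativeM fk gl.
apply: sqintegrableD; last exact: AC_sqintegrableM fk.1 l2.
have := AC_sqintegrableM gl.1 k2.
by congr sqintegrable; apply/funext => t; rewrite mulrC.
Qed.

Lemma sobolevB f g : sobolev f -> sobolev g -> sobolev (fun t => f t - g t).
Proof.
move=> [k fk k2] [l gl l2]; exists (fun t => k t - l t).
  exact: ae_derivativeB.
exact: sqintegrableB.
Qed.

Lemma sobolev_cst (z : R[i]) : sobolev (fun _ => z).
Proof.
by exists (fun _ => 0); [exact: ae_derivative_cst|exact: AC_sqintegrable (AC_cst 0)].
Qed.

Lemma sobolevX f n : sobolev f -> sobolev (fun t => f t ^+ n).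
Proof.
move=> sf; elim: n => [|n IH]; first by under eq_fun do rewrite expr0; exact: sobolev_cst.
by under eq_fun do rewrite exprS; exact: sobolevM.
Qed.

Lemma MVT_increment (r dr : R -> R) (s t : R) : s <= t ->
  (forall u, s <= u <= t -> is_derive u (1 : R) r (dr u)) ->
  exists2 u, s <= u <= t & r t - r s = dr u * (t - s).
Proof.
move=> st rd; have [||u] := @MVT_segment _ r dr s t st.
- by move=> u; rewrite in_itv /= => /andP[/ltW su /ltW ut]; apply: rd; rewrite su.
- apply: derivable_within_continuous => u; rewrite in_itv /= => sut.
  by have [] := rd u sut.
by rewrite in_itv /= => ? ?; exists u.
Qed.

Lemma ae_derivative_C1 (r dr : R -> R) (K : R) :
  (forall t : R, 0 <= t <= 1 -> is_derive t (1 : R) r (dr t)) ->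
  (forall t, 0 <= t <= 1 -> `|dr t| <= K) ->
  ae_derivative (fun t => (r t)%:C) (fun t => (dr t)%:C).
Proof.
move=> rd drK; split.
  apply: (@AC_lipschitz _ _ K) => s t s0 st t1.
  have [|u /andP[su ut] E] := @MVT_increment r dr s t st.
    by move=> u /andP[su ut]; apply: rd; rewrite (le_trans s0 su) (le_trans ut t1).
  rewrite -rmorphB normc_real E normrM (ger0_norm (_ : 0 <= t - s)) ?subr_ge0//.
  by rewrite ler_wpM2r ?subr_ge0// drK// (le_trans s0 su) (le_trans ut t1).
apply: aeW => t /andP[t0 t1]; split; last exact: is_derive_cst.
by apply: rd; rewrite !ltW.
Qed.

Let closure_dom : set (L2 R) :=
  [set x | forall e : R, 0 < e -> exists2 y, dom (T0 R) y & hnorm (x - y) < e].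

Let closure_dom_idem x :
  (forall e : R, 0 < e -> exists2 y, closure_dom y & hnorm (x - y) < e) ->
  closure_dom x.
Proof.
move=> xcl e e0; have e20 : 0 < e / 2 by rewrite divr_gt0.
have [y cly xy] := xcl _ e20; have [z Tz yz] := cly _ e20; exists z => //.
rewrite (_ : x - z = (x - y) + (y - z)); last by rewrite addrA subrK.
by apply: le_lt_trans (hnormD _ _) _; rewrite [ltRHS]splitr ltrD.
Qed.

Let dom_T0D x y (d : R[i]) : dom (T0 R) x -> dom (T0 R) y -> dom (T0 R) (x + d *: y).
Proof.
move=> [w /T0E[f [k [fk k2 [f0 f1] -> _]]]] [w' /T0E[g [l [gl l2 [g0 g1] -> _]]]].
have f2 := AC_sqintegrable fk.1; have g2 := AC_sqintegrable gl.1.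
exists (L2of (fun t => k t + d * l t)); apply/T0E.
exists (fun t => f t + d * g t), (fun t => k t + d * l t); split => //.
- by apply: ae_derivativeD => //; exact: ae_derivativeZ.
- by apply: sqintegrableD => //; exact: sqintegrableZ.
- by rewrite f0 f1 g0 g1 mulr0 addr0.
- by rewrite L2ofD// ?L2ofZ//; exact: sqintegrableZ.
Qed.

Let closure_domD x y (d : R[i]) :
  closure_dom x -> closure_dom y -> closure_dom (x + d *: y).
Proof.
move=> clx cly e e0; have e20 : 0 < e / 2 by rewrite divr_gt0.
have d0 : 0 < normc d + 1 by rewrite ltr_wpDl ?normc_ge0.
have [x' Tx xx'] := clx _ e20; have [y' Ty yy'] := cly _ (divr_gt0 e20 d0).
exists (x' + d *: y'); first exact: dom_T0D.
rewrite (_ : _ - _ = (x - x') + d *: (y - y')); last first.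
  by rewrite scalerBr opprD addrACA.
apply: le_lt_trans (hnormD _ _) _; rewrite [ltRHS]splitr ltrD// hnormZ.
apply: le_lt_trans (_ : (normc d + 1) * hnorm (y - y') < _).
  by rewrite ler_wpM2r ?hnorm_ge0// lerDl.
by rewrite mulrC -ltr_pdivlMr.
Qed.

Let rsqintegrable a := sqintegrable (fun t => (a t)%:C).

Let rsqintegrableP a : measurable_fun I01 a ->
  mu.-integrable I01 (EFin \o (fun t => a t ^+ 2)) -> rsqintegrable a.
Proof.
move=> ma a2; split; [exact: ma|exact: measurable_cst|].
by move: a2; congr (_.-integrable _ _); apply/funext => t; rewrite /normc2 /= expr0n addr0.
Qed.

Let hnorm_rsqintegrableB a b : rsqintegrable a -> rsqintegrable b ->
  hnorm (L2of (fun t => (a t)%:C) - L2of (fun t => (b t)%:C)) ^+ 2 =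
  \int[mu]_(t in I01) ((a t - b t) ^+ 2).
Proof.
move=> a2 b2; rewrite -L2ofB// hnorm_sqr_L2of; last exact: sqintegrableB.
apply: eq_Rintegral => t _; rewrite -rmorphB normc2E normc_real.
by rewrite real_normK ?num_real.
Qed.

Let rsqintegrable_sqr a : rsqintegrable a -> measurable_fun I01 a /\
  mu.-integrable I01 (EFin \o (fun t => a t ^+ 2)).
Proof.
by move=> [ma _ a2]; split; [exact: ma|exact: (sqintegrable_Re (k := fun t => (a t)%:C))].
Qed.

(** Dominated convergence, applied to [(a - u n)^2 <= 2 a^2 + 2 b^2]. *)
Let closure_dom_dominated a (u : nat -> R -> R) b :
  rsqintegrable a -> (forall n, rsqintegrable (u n)) -> rsqintegrable b ->
  (forall n, closure_dom (L2of (fun t => (u n t)%:C))) ->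
  (forall t, 0 < t < 1 -> u n t @[n --> \oo] --> a t) ->
  (forall n t, 0 < t < 1 -> `|u n t| <= b t) ->
  closure_dom (L2of (fun t => (a t)%:C)).
Proof.
move=> a2 u2 b2 clu ua ub; apply: closure_dom_idem => e e0.
have [ma ia] := rsqintegrable_sqr a2; have [mb ib] := rsqintegrable_sqr b2.
have mu_ n := (rsqintegrable_sqr (u2 n)).1.
have mI01 : measurable I01 by exact: measurable_itv.
have id : mu.-integrable I01
    (fun t => (2%:E * (a t ^+ 2)%:E + 2%:E * (b t ^+ 2)%:E)%E).
  by apply: integrableD => //; exact: integrableZl.
have := @dominated_cvg _ _ _ mu I01 mI01 (fun n t => ((a t - u n t) ^+ 2)%:E)
  (fun t => 0%E) _ _ _ _ id.
rewrite integral0 => H; have {}H := H _ _ _ _.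
have /fine_cvgP[_ /cvgrPdist_lt] :
    (\int[mu]_(t in I01) ((a t - u n t) ^+ 2)%:E)%E @[n --> \oo] --> 0%E.
  apply: H.
  - move=> n; apply/measurable_EFinP.
    by apply: (measurableT_comp (exprn_measurable 2)); exact: measurable_funB ma (mu_ n).
  - move=> t; rewrite /= in_itv /= => t01; apply/cvg_EFin; first exact: nearW.
    have h0 : a t - u n t @[n --> \oo] --> a t - a t.
      by apply: cvgB; [exact: cvg_cst|exact: ua].
    by have := cvgM h0 h0; rewrite subrr mulr0; exact.
  - by move=> t _; rewrite -!EFinM -EFinD.
  - move=> n t; rewrite /= in_itv /= => t01; rewrite -!EFinM -EFinD lee_fin.
    rewrite ger0_norm ?sqr_ge0//; have := ub n _ t01; rewrite ler_norml => /andP[? ?].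
    have := sqr_ge0 (a t + u n t).
    have : u n t ^+ 2 <= b t ^+ 2 by rewrite -subr_ge0 subr_sqr mulr_ge0//; lra.
    rewrite sqrrB sqrrD !mulr2n; lra.
move=> /(_ _ (exprn_gt0 2 e0))[n _ /(_ n (leqnn n))].
rewrite sub0r normrN => Hn; exists (L2of (fun t => (u n t)%:C)) => //.
rewrite -(@ltr_pXn2r _ 2)// ?nnegrE ?hnorm_ge0 ?(ltW e0)// hnorm_rsqintegrableB//.
exact: le_lt_trans (ler_norm _) Hn.
Qed.

Let sub_closure_dom x : dom (T0 R) x -> closure_dom x.
Proof. by move=> Tx e e0; exists x => //; rewrite subrr hnorm0. Qed.

Let bounded_rsqintegrable a (N : R) : measurable_fun I01 a ->
  (forall t, 0 < t < 1 -> `|a t| <= N) -> rsqintegrable a.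
Proof.
move=> ma aN; apply: (bounded_sqintegrable (M := N)); [exact: ma|exact: measurable_cst|].
by move=> t /aN; rewrite normc_real.
Qed.

Let continuous_measurable01 c : continuous c -> measurable_fun I01 c.
Proof. by move=> cc; apply: measurable_funTS; exact: continuous_measurable_fun. Qed.

(** Difference quotients [G n] of a primitive of [c], multiplied by the cutoffs
    [chi n], which vanish at 0 and 1 and tend to 1 in between. *)
Let closure_dom_continuous c (N : R) : continuous c -> (forall t, `|c t| <= N) ->
  closure_dom (L2of (fun t => (c t)%:C)).
Proof.
move=> cc cN; have c2 : rsqintegrable c.
  by apply: (@bounded_rsqintegrable _ N) => //; exact: continuous_measurable01.
pose C (y : R) := \int[mu]_(t in `[(-1)%R, y]) c t.
have dC (t : R) : -1 < t -> is_derive t (1 : R) C (c t).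
  move=> t1; have tt : t < t + 1 by rewrite ltrDl.
  have ic : mu.-integrable `[(-1)%R, t + 1] (EFin \o c).
    apply: continuous_compact_integrable; first exact: segment_compact.
    exact: continuous_subspaceT.
  have [] := continuous_FTC1_closed tt ic t1 (cc t).
  by rewrite derive1E; split.
pose G n (t : R) : R := n.+1%:R * (C (t + n.+1%:R^-1) - C t).
have hn0 n : 0 < n.+1%:R^-1 :> R by rewrite invr_gt0.
have GE n (t : R) : 0 <= t -> exists2 xi, t <= xi <= t + n.+1%:R^-1 & G n t = c xi.
  move=> t0; have [||xi txi E] := @MVT_increment C c t (t + n.+1%:R^-1).
  - by rewrite lerDl ltW.
  - by move=> u /andP[tu _]; apply: dC; rewrite (lt_le_trans _ tu)// (lt_le_trans _ t0)// ltrN10.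
  exists xi => //; rewrite /G E addrAC subrr add0r mulrCA mulfV ?mulr1//.
pose chi n (t : R) : R := 1 - ((2 * t - 1) ^+ 2) ^+ n.+1.
have q01 (t : R) : 0 <= t <= 1 -> 0 <= (2 * t - 1) ^+ 2 <= 1.
  by move=> /andP[? ?]; rewrite sqr_ge0/=; nra.
have chi01 n (t : R) : 0 <= t <= 1 -> `|chi n t| <= 1.
  move=> /q01/andP[q0 q1]; have := exprn_ge0 n.+1 q0.
  have := exprn_ile1 n.+1 q0 q1.
  by rewrite /chi ler_norml => *; apply/andP; split; lra.
pose u n (t : R) := chi n t * G n t.
have uN n t : 0 <= t <= 1 -> `|u n t| <= N.
  move=> t01; have [|xi _ Gxi] := GE n t; first by case/andP: t01.
  by rewrite normrM Gxi -[leRHS]mul1r; apply: ler_pM => //; exact: chi01.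
have sid : sobolev (fun t : R => t%:C).
  exists (fun _ => 1); first exact: ae_derivative_id.
  exact: AC_sqintegrable (AC_cst 1).
have su n : sobolev (fun t => (u n t)%:C).
  rewrite (_ : (fun t => (u n t)%:C) =
    (fun t => (1 - ((2 * t%:C - 1) ^+ 2) ^+ n.+1) * (G n t)%:C)); last first.
    apply/funext => t; rewrite /u /chi rmorphM rmorphB !rmorphXn /=.
    by rewrite rmorphB rmorphM rmorph1 rmorph_nat.
  apply: sobolevM.
    apply: sobolevB; first exact: sobolev_cst.
    do 2 apply: sobolevX; apply: sobolevB; last exact: sobolev_cst.
    by apply: sobolevM => //; exact: sobolev_cst.
  pose dG (t : R) := n.+1%:R * (c (t + n.+1%:R^-1) - c t).
  have dGN t : `|dG t| <= n.+1%:R * (N + N).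
    rewrite normrM normr_nat ler_wpM2l//.
    by apply: le_trans (ler_normB _ _) _; rewrite lerD.
  exists (fun t => (dG t)%:C).
    apply: (@ae_derivative_C1 _ _ (n.+1%:R * (N + N))) => // t /andP[t0 t1].
    have d1 : is_derive t (1 : R) C (c t) by apply: dC; rewrite (lt_le_trans _ t0)// ltrN10.
    have d2 : is_derive (t + n.+1%:R^-1) (1 : R) C (c (t + n.+1%:R^-1)).
      by apply: dC; rewrite (lt_trans (ltrN10 R))// ltr_wpDl.
    have d3 : is_derive t (1 : R) (fun s => C (s + n.+1%:R^-1)) (c (t + n.+1%:R^-1)).
      have ds : is_derive t (1 : R) (fun s : R => s + n.+1%:R^-1) 1 by exact: is_derive_shift.
      by have := @is_derive1_comp _ _ (fun s : R => s + n.+1%:R^-1) t _ _ d2 ds; rewrite mulr1.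
    have -> : G n = n.+1%:R *: ((fun s => C (s + n.+1%:R^-1)) - C) by [].
    exact: is_deriveZ.
  apply: (@bounded_rsqintegrable _ (n.+1%:R * (N + N))) => //.
  apply: measurable_funM; first exact: measurable_cst.
  apply: measurable_funB; last exact: continuous_measurable01.
  apply: continuous_measurable01 => s.
  by apply: continuous_comp; [apply: cvgD; [exact: cvg_id|exact: cvg_cst]|exact: cc].
have u2 n : rsqintegrable (u n).
  by have [k [ACu _] _] := su n; exact: AC_sqintegrable.
apply: (@closure_dom_dominated c u (cst N)) => //.
- by apply: (@bounded_rsqintegrable _ `|N|) => // t _; rewrite lexx.
- move=> n; apply: sub_closure_dom; have [k uk k2] := su n.
  exists (L2of k); apply/T0E; exists (fun t => (u n t)%:C), k; split=> //.
  rewrite /u /chi !mulr0 !mulr1 sub0r sqrrN (_ : 2 - 1 = 1 :> R); last by ring.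
  by rewrite !expr1n subrr !mul0r.
- move=> t /andP[t0 t1]; rewrite -[X in _ --> X]mul1r; apply: cvgM.
    rewrite -[X in _ --> X]subr0; apply: cvgB; first exact: cvg_cst.
    rewrite /= (cvg_shiftS (fun n => ((2 * t - 1) ^+ 2) ^+ n)).
    apply: cvg_expr; rewrite ger0_norm ?sqr_ge0//; nra.
  apply/cvgrPdist_lt => e e0.
  have /cvgrPdist_lt /(_ _ e0) /nbhs_ballP[d /= d0 Hd] := cc t.
  near=> n; have [xi /andP[txi xit] ->] := GE n t (ltW t0).
  apply: Hd; rewrite /ball /= distrC ger0_norm ?subr_ge0// ltrBlDl.
  apply: le_lt_trans xit _; rewrite ltrD2l.
  by near: n; exact: near_infty_natSinv_lt (PosNum d0).
- by move=> n t /andP[t0 t1]; apply: uN; rewrite !ltW.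
Unshelve. all: by end_near.
Qed.

Let clip (N s : R) := Num.max (- N) (Num.min s N).

Let clip_norm (N s : R) : 0 <= N -> `|clip N s| <= N.
Proof.
move=> N0; rewrite ler_norml /clip le_max lexx /= ge_max ge_min lexx orbT andbT.
by lra.
Qed.

Let clip_id (N s : R) : `|s| <= N -> clip N s = s.
Proof.
by rewrite ler_norml /clip => /andP[Ns sN]; rewrite (min_idPl sN) (max_idPr Ns).
Qed.

Let clip_dist (N s t : R) : `|t| <= N -> `|t - clip N s| <= `|t - s|.
Proof.
rewrite ler_norml /clip => /andP[Nt tN].
have [sN|Ns] := leP s N.
  have [//|sN'] := leP (- N) s.
  by rewrite [X in X <= _]ger0_norm ?[X in _ <= X]ger0_norm; lra.
rewrite (max_idPr _); last lra.
by rewrite [X in X <= _]ler0_norm ?[X in _ <= X]ler0_norm; lra.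
Qed.

(** Continuous functions are dense in L^1, hence, among functions bounded by [N],
    also in L^2, since [|a - c|^2 <= 2 N |a - c|]. *)
Let closure_dom_bounded a (N : R) : 0 <= N -> measurable_fun I01 a -> (forall t, `|a t| <= N) ->
  closure_dom (L2of (fun t => (a t)%:C)).
Proof.
move=> N0 ma aN; have a2 : rsqintegrable a by apply: (@bounded_rsqintegrable _ N).
have [_ ia2] := rsqintegrable_sqr a2; have ia := sqintegrable_integrable ma ia2.
have mI01 : measurable I01 by exact: measurable_itv.
have I01_lty : (mu I01 < +oo)%E.
  by rewrite lebesgue_measure_itv /= lte_fin ltr01 oppr0 adde0 ltry.
have [g [cg ig ga]] := approximation_continuous_integrable mI01 I01_lty ia.
apply: closure_dom_idem => e e0.
have d0 : 0 < e ^+ 2 / (2 * N + 1) by rewrite divr_gt0 ?exprn_gt0//; lra.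
have /fine_cvgP[_ /cvgrPdist_lt] := ga; move=> /(_ _ d0)[n _ /(_ n (leqnn n))].
rewrite sub0r normrN => Hn.
pose c t := clip N (g n t).
have cc : continuous c.
  move=> t; apply: (@continuous_max _ _ (cst (- N)) (fun s => Num.min (g n s) N)).
    exact: cvg_cst.
  by apply: (@continuous_min _ _ (g n) (cst N)); [exact: cg|exact: cvg_cst].
have cN t : `|c t| <= N by exact: clip_norm.
have c2 : rsqintegrable c by apply: (@bounded_rsqintegrable _ N) => //; exact: continuous_measurable01.
exists (L2of (fun t => (c t)%:C)); first exact: closure_dom_continuous cc cN.
rewrite -(@ltr_pXn2r _ 2)// ?nnegrE ?hnorm_ge0 ?(ltW e0)// hnorm_rsqintegrableB//.
have iag : mu.-integrable I01 (EFin \o (fun t => `|a t - g n t|)).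
  apply: (@integrable_norm _ _ _ mu I01 (fun t => a t - g n t)).
  by have := @integrableB _ _ _ mu I01 mI01 _ _ ia (ig n).
have [mc ic2] := rsqintegrable_sqr c2.
apply: (@le_lt_trans _ _ (\int[mu]_(t in I01) (2 * N * `|a t - g n t|))).
  apply: le_Rintegral => //.
  - have := sqintegrable_Re (sqintegrableB a2 c2).
    by congr (_.-integrable _ _); apply/funext => t /=.
  - by have := @integrableZl _ _ _ mu I01 mI01 (2 * N) _ iag.
  - move=> t _; rewrite -[leLHS]ger0_norm ?sqr_ge0// normrX expr2.
    apply: ler_pM => //; last exact: clip_dist.
    by apply: le_trans (ler_normB _ _) _; rewrite mulrDl mul1r lerD.
rewrite RintegralZl//; set I := Rintegral _ _ _ in Hn *.
have {}Hn : \int[mu]_(t in I01) `|a t - g n t| < e ^+ 2 / (2 * N + 1).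
  by apply: le_lt_trans (ler_norm _) Hn.
have I0 : 0 <= \int[mu]_(t in I01) `|a t - g n t| by exact: Rintegral_ge0.
apply: (@le_lt_trans _ _ ((2 * N + 1) * \int[mu]_(t in I01) `|a t - g n t|)).
  by rewrite ler_wpM2r// lerDl.
by rewrite mulrC -ltr_pdivlMr//; lra.
Qed.

(** The truncations of [a] converge to [a] and are dominated by [|a|]. *)
Let closure_dom_real a : rsqintegrable a -> closure_dom (L2of (fun t => (a t)%:C)).
Proof.
move=> a2; have [ma _] := rsqintegrable_sqr a2.
pose u n t := clip n%:R (a t).
have mu_ n : measurable_fun I01 (u n).
  apply: (@measurable_maxr _ _ _ _ (cst (- n%:R)) (fun t => Num.min (a t) n%:R)).
    exact: measurable_cst.
  by apply: (@measurable_minr _ _ _ _ a (cst n%:R)).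
have un n t : `|u n t| <= n%:R by exact: clip_norm.
apply: (@closure_dom_dominated a u (fun t => `|a t|)) => //.
- by move=> n; apply: (@bounded_rsqintegrable _ n%:R).
- apply: rsqintegrableP; first exact: measurableT_comp.
  have [_] := rsqintegrable_sqr a2; congr (_.-integrable _ _); apply/funext => t /=.
  by rewrite real_normK ?num_real.
- by move=> n; apply: (@closure_dom_bounded _ n%:R).
- move=> t _; apply: cvg_near_cst; near=> n; apply: clip_id.
  by near: n; exact: nbhs_infty_ger.
- move=> n t _; have [an|/ltW na] := leP `|a t| n%:R; first by rewrite /u clip_id.
  exact: le_trans (un n t) na.
Unshelve. all: by end_near.
Qed.

Lemma densely_defined_T0 : densely_defined (T0 R).
Proof.
move=> x; have [f f2 ->] := L2of_repr x; have [mr mi _] := f2.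
have r2 : rsqintegrable (fun t => Re (f t)) by apply: rsqintegrableP => //; exact: sqintegrable_Re.
have i2 : rsqintegrable (fun t => Im (f t)) by apply: rsqintegrableP => //; exact: sqintegrable_Im.
have -> : f = (fun t => (Re (f t))%:C + 'i * (Im (f t))%:C).
  by apply/funext => t; exact: complexE.
rewrite L2ofD// ?L2ofZ//; last exact: sqintegrableZ.
by apply: closure_domD; exact: closure_dom_real.
Qed.

End Density.

(** * Linear differential equations of first order *)

Section Exponential.
Context {R : realType}.
Implicit Types (m : R[i]) (t : R) (f h p : R -> R[i]).

(** [exp (m t)], in terms of the real exponential and trigonometric functions. *)
Definition cexp m t : R[i] :=
  (expR (Re m * t) * cos (Im m * t)) +i* (expR (Re m * t) * sin (Im m * t)).

Lemma cexp0 m : cexp m 0 = 1.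
Proof. by rewrite /cexp !mulr0 expR0 cos0 sin0 mulr1 mulr0. Qed.

Lemma cexpN m t : cexp m t * cexp (- m) t = 1.
Proof.
case: m => a b; rewrite /cexp /= !mulNr cosN sinN expRN.
have := cos2Dsin2 (b * t); set C := cos _; set S := sin _ => CS.
have e0 : expR (a * t) != 0 by rewrite gt_eqF ?expR_gt0.
apply/eqP; rewrite eq_complex /=; apply/andP; split; apply/eqP; last by field.
rewrite -CS; by field.
Qed.

Lemma normc_cexp m t : normc (cexp m t) = expR (Re m * t).
Proof.
apply/eqP; rewrite -(@eqrXn2 _ 2)// ?normc_ge0 ?expR_ge0//.
by rewrite normc_sqr /= !exprMn -mulrDr cos2Dsin2 mulr1.
Qed.

Lemma normc_cexp_le m t : 0 <= t <= 1 -> normc (cexp m t) <= expR `|Re m|.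
Proof.
move=> /andP[t0 t1]; rewrite normc_cexp ler_expR.
apply: le_trans (ler_norm _) _; rewrite normrM (ger0_norm t0).
by rewrite -[leRHS]mulr1 ler_wpM2l.
Qed.

Lemma ae_derivative_cexp m : ae_derivative (cexp m) (fun t => m * cexp m t).
Proof.
(* a Lipschitz constant on [0, 1] *)
pose K := (`|Re m| + `|Im m|) * expR `|Re m|.
have de t : is_derive t (1 : R) (fun s => expR (Re m * s)) (Re m * expR (Re m * t)).
  have dm : is_derive t (1 : R) (fun s => Re m * s) (Re m).
    by apply: is_derive_eq; rewrite [_ *: _]mulr1.
  by have := @is_derive1_comp _ (@expR R) _ t _ _ (is_derive_expR _) dm; rewrite mulrC.
have dc t : is_derive t (1 : R) (fun s => cos (Im m * s)) (- (Im m * sin (Im m * t))).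
  have dm : is_derive t (1 : R) (fun s => Im m * s) (Im m).
    by apply: is_derive_eq; rewrite [_ *: _]mulr1.
  by have := @is_derive1_comp _ (@cos R) _ t _ _ (is_derive_cos _) dm; rewrite mulNr mulrC.
have ds t : is_derive t (1 : R) (fun s => sin (Im m * s)) (Im m * cos (Im m * t)).
  have dm : is_derive t (1 : R) (fun s => Im m * s) (Im m).
    by apply: is_derive_eq; rewrite [_ *: _]mulr1.
  by have := @is_derive1_comp _ (@sin R) _ t _ _ (is_derive_sin _) dm; rewrite mulrC.
have K_bound t (u v : R) : 0 <= t <= 1 -> `|u| <= 1 -> `|v| <= 1 ->
    `|expR (Re m * t) * (Re m * u + Im m * v)| <= K.
  move=> /(normc_cexp_le m); rewrite normc_cexp => eK u1 v1.
  rewrite normrM (ger0_norm (expR_ge0 _)) /K mulrC ler_pM ?expR_ge0//.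
  apply: le_trans (ler_normD _ _) _; rewrite !normrM.
  by rewrite lerD// -[leRHS]mulr1 ler_wpM2l.
have dre : ae_derivative (fun t => (Re (cexp m t))%:C) (fun t => (Re (m * cexp m t))%:C).
  apply: (@ae_derivative_C1 _ _ _ K) => t t01.
    apply: (is_derive_eq (is_deriveM (de t) (dc t))).
    rewrite /cexp; case: (m) => a b /=; rewrite /GRing.scale /=; ring.
  rewrite (_ : Re _ = expR (Re m * t) * (Re m * cos (Im m * t) + Im m * (- sin (Im m * t)))).
    by apply: K_bound; rewrite // ?normrN ?cos_max ?sin_max.
  rewrite /cexp; case: (m) => a b /=; ring.
have dim : ae_derivative (fun t => (Im (cexp m t))%:C) (fun t => (Im (m * cexp m t))%:C).
  apply: (@ae_derivative_C1 _ _ _ K) => t t01.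
    apply: (is_derive_eq (is_deriveM (de t) (ds t))).
    rewrite /cexp; case: (m) => a b /=; rewrite /GRing.scale /=; ring.
  rewrite (_ : Im _ = expR (Re m * t) * (Re m * sin (Im m * t) + Im m * cos (Im m * t))).
    by apply: K_bound; rewrite // ?cos_max ?sin_max.
  rewrite /cexp; case: (m) => a b /=; ring.
have := ae_derivativeD dre (ae_derivativeZ 'i dim).
have E f : (fun t => (Re (f t))%:C + 'i * (Im (f t))%:C) = f.
  by apply/funext => t; rewrite -complexE.
by rewrite (E (cexp m)) (E (fun t => m * cexp m t)).
Qed.

(** [p exp (- m t)] has derivative 0 almost everywhere. *)
Lemma ae_derivative_exp_unique m p : ae_derivative p (fun t => m * p t) ->
  forall t, 0 <= t <= 1 -> p t = p 0 * cexp m t.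
Proof.
move=> pm t t01; have eN := ae_derivative_cexp (- m).
have [AC' d] := ae_derivativeM pm eN.
have /(_ t t01) : forall t, 0 <= t <= 1 -> p t * cexp (- m) t = p 0 * cexp (- m) 0.
  apply: AC_derive0_cst => //; move: d; apply: filterS => s /[apply].
  by rewrite (_ : _ + _ = 0)//; ring.
rewrite cexp0 mulr1 => <-.
by rewrite -mulrA [cexp (- m) t * _]mulrC cexpN mulr1.
Qed.

(** Variation of constants: [V] is [exp (m t)] times the primitive of
    [exp (- m t) h]. *)
Lemma exists_ode_solution m h : sqintegrable h ->
  exists V, [/\ V 0 = 0, ae_derivative V (fun t => m * V t + h t) &
    forall t, 0 <= t <= 1 ->
      normc (V t) <= 2 * expR `|Re m| ^+ 2 * hnorm (L2of h)].
Proof.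
move=> h2; have eN := ae_derivative_cexp (- m).
have eh2 := AC_sqintegrableM eN.1 h2.
have [P [dP P0 _ PB]] := exists_primitive eh2.
exists (fun t => cexp m t * P t); split; first by rewrite P0 mulr0.
  have := ae_derivativeM (ae_derivative_cexp m) dP.
  by apply: eq_ae_derivative => t; rewrite !mulrA cexpN mul1r.
move=> t t01; rewrite Normc.normcM.
have le_eh : hnorm (L2of (fun t => cexp (- m) t * h t)) <= expR `|Re m| * hnorm (L2of h).
  have -> : expR `|Re m| * hnorm (L2of h) = hnorm (L2of (fun t => (expR `|Re m|)%:C * h t)).
    by rewrite L2ofZ// hnormZ normc_real (ger0_norm (expR_ge0 _)).
  apply: le_hnorm_L2of => //; first exact: sqintegrableZ.
  move=> s /andP[s0 s1]; rewrite !Normc.normcM ler_wpM2r ?normc_ge0//.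
  rewrite normc_real (ger0_norm (expR_ge0 _)).
  apply: le_trans (normc_cexp_le _ _) _; first by rewrite !ltW.
  by case: (m) => a b /=; rewrite normrN.
have := le_trans (PB t) (integral_ReIm_le_hnorm eh2) => {}PB.
have -> : 2 * expR `|Re m| ^+ 2 * hnorm (L2of h) =
  expR `|Re m| * (2 * (expR `|Re m| * hnorm (L2of h))) by ring.
apply: ler_pM; rewrite ?normc_ge0 ?normc_cexp_le//.
by apply: le_trans PB _; rewrite ler_wpM2l.
Qed.

End Exponential.

(** * The operator A *)

Section SpectrumOfA.
Context {R : realType}.
Implicit Types (f g h k : R -> R[i]) (lam : R[i]).

Let ii : 'i%C * 'i%C = -1 :> R[i].
Proof. by rewrite -expr2 sqr_i. Qed.

Let i0 : ('i%C : R[i]) != 0.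
Proof. by apply/eqP => -[] /eqP; rewrite oner_eq0. Qed.

Let i2 : (2 * 'i%C : R[i]) != 0.
Proof.
by rewrite mulf_neq0 ?pnatr_eq0// i0. Qed.

Lemma opAE (x y : L2 R * L2 R) : opA R x y <-> T0_star R x.2 y.1 /\ T0 R x.1 y.2.
Proof.
rewrite -adjoint_T0; split.
  move=> [a [b [c [d [-> Tb Tc -> ->]]]]] /=.
  by rewrite !scale0r add0r addr0.
move=> [Ty1 Ty2]; exists 0, y.1, y.2, 0; rewrite /op_scalar !scale0r; split=> //.
by rewrite add0r addr0 -surjective_pairing.
Qed.

Lemma self_adjoint_opA : self_adjoint (opA R).
Proof.
split.
  move=> x e e0; have e20 : 0 < e / 2 by rewrite divr_gt0.
  have [y1 [w1 T1] xy1] := densely_defined_T0 x.1 e20.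
  have [y2 [w2 T2] xy2] := densely_defined_T0 x.2 e20.
  have T2' : T0_star R y2 (- w2).
    move: T2 => /T0E[f [k [fk k2 _ -> ->]]]; apply/T0_starE.
    by exists f, k.
  exists (y1, y2); first by exists (- w2, w1); apply/opAE.
  by apply: le_lt_trans (hnorm_pair_le _) _; rewrite [ltRHS]splitr ltrD.
apply: opP => z w; split.
  move=> /opAE[Tsz Tz] x y /opAE[Tsx Tx]; rewrite !inner_pairE.
  rewrite -adjoint_T0 in Tsz; rewrite -adjoint_T0_star in Tz.
  by rewrite (Tsz _ _ Tx) (Tz _ _ Tsx) addrC.
move=> zw; have T00 : T0 R 0 0.
  rewrite -adjoint_T0_star => a b _; by rewrite !inner0r.
have Ts00 : T0_star R 0 0.
  rewrite -adjoint_T0 => a b _; by rewrite !inner0r.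
apply/opAE; split.
  rewrite -adjoint_T0 => a b Tab.
  have := zw (a, 0) (0, b); rewrite !inner_pairE /= !inner0l add0r addr0; apply.
  exact/opAE.
rewrite -adjoint_T0_star => a b Tab.
have := zw (0, a) (b, 0); rewrite !inner_pairE /= !inner0l add0r addr0; apply.
exact/opAE.
Qed.

(** The system [f' = lam g + s], [g' = - lam f - r], that is
    [(A - lam) (f, g) = (r, s)], decouples in these unknowns. *)
Lemma ae_derivative_decoupled f g k l :
  ae_derivative f k -> ae_derivative g l ->
  ae_derivative (fun t => g t + 'i%C * f t) (fun t => l t + 'i%C * k t) /\
  ae_derivative (fun t => g t - 'i%C * f t) (fun t => l t - 'i%C * k t).
Proof.
move=> fk gl; have ifk := ae_derivativeZ 'i%C fk.
by split; [exact: ae_derivativeD|exact: ae_derivativeB].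
Qed.

Let sn lam t : R[i] := (cexp ('i%C * lam) t - cexp (- ('i%C * lam)) t) / (2 * 'i%C).
Let cs lam t : R[i] := (cexp ('i%C * lam) t + cexp (- ('i%C * lam)) t) / 2.

(** The class of [(sin (lam t), cos (lam t))], for complex [lam]. *)
Definition eigenvectorA lam : L2 R * L2 R := (L2of (sn lam), L2of (cs lam)).

(** This is [2 i sin lam], which up to a constant factor is the second boundary value
    of the first component of [eigenvectorA lam]. *)
Definition discriminantA lam : R[i] := cexp ('i%C * lam) 1 - cexp (- ('i%C * lam)) 1.

Let sqint_cexp m : sqintegrable (cexp m : R -> R[i]).
Proof. exact: AC_sqintegrable (ae_derivative_cexp m).1. Qed.

Let sn_derivative lam : ae_derivative (sn lam) (fun t => lam * cs lam t).
Proof.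
have d1 := ae_derivative_cexp ('i%C * lam : R[i]).
have d2 := ae_derivative_cexp (- ('i%C * lam) : R[i]).
have := ae_derivativeZ (2 * 'i%C)^-1 (ae_derivativeB d1 d2).
rewrite (_ : (fun t => (2 * 'i%C)^-1 * _) = sn lam); last first.
  by apply/funext => t; rewrite mulrC.
by apply: eq_ae_derivative => t; rewrite /cs; field; exact: i0.
Qed.

Let cs_derivative lam : ae_derivative (cs lam) (fun t => - lam * sn lam t).
Proof.
have d1 := ae_derivative_cexp ('i%C * lam : R[i]).
have d2 := ae_derivative_cexp (- ('i%C * lam) : R[i]).
have := ae_derivativeZ 2^-1 (ae_derivativeD d1 d2).
rewrite (_ : (fun t => 2^-1 * _) = cs lam); last first.
  by apply/funext => t; rewrite mulrC.
apply: eq_ae_derivative => t; rewrite /sn.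
set a := cexp _ _; set b := cexp _ _.
have -> : - lam * ((a - b) / (2 * 'i%C)) = ('i%C * 'i%C) * lam * ((a - b) / (2 * 'i%C)).
  by rewrite ii mulN1r.
by field; exact: i0.
Qed.

(** By uniqueness, [g + i f] and [g - i f] are multiples of exponentials with the common
    initial value [g 0], since [f 0 = 0]. The condition [f 1 = 0] is the equation for
    [c = g 0]. *)
Lemma opA_eigenvector lam (x : L2 R * L2 R) : opA R x (lam *: x) ->
  exists2 c, x = c *: eigenvectorA lam & c * discriminantA lam = 0.
Proof.
case: x => x1 x2 /opAE[/= /T0_starE[g [l [gl l2 x2E Tsx]]]].
move=> /T0E[f [k [fk k2 [f0 f1] x1E Tx]]].
have f2 := AC_sqintegrable fk.1; have g2 := AC_sqintegrable gl.1.
have fk' : ae_derivative f (fun t => lam * g t).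
  apply: ae_derivative_ae fk _; apply/L2of_eqP => //; first exact: sqintegrableZ.
  by rewrite L2ofZ// -x2E.
have gl' : ae_derivative g (fun t => - lam * f t).
  apply: ae_derivative_ae gl _; apply/L2of_eqP => //; first exact: sqintegrableZ.
  by rewrite L2ofZ// -x1E scaleNr Tsx opprK.
have [dp dq] := ae_derivative_decoupled fk' gl'.
have pE t : 0 <= t <= 1 -> g t + 'i%C * f t = g 0 * cexp ('i%C * lam) t.
  move=> t01; have := @ae_derivative_exp_unique _ ('i%C * lam) (fun t => g t + 'i%C * f t) _ t t01.
  rewrite /= f0 mulr0 addr0; apply; apply: eq_ae_derivative dp => s.
  have -> : - lam * f s = ('i%C * 'i%C) * lam * f s by rewrite ii mulN1r.
  by ring.
have qE t : 0 <= t <= 1 -> g t - 'i%C * f t = g 0 * cexp (- ('i%C * lam)) t.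
  move=> t01; have := @ae_derivative_exp_unique _ (- ('i%C * lam)) (fun t => g t - 'i%C * f t) _ t t01.
  rewrite /= f0 mulr0 subr0; apply; apply: eq_ae_derivative dq => s.
  have -> : - lam * f s = ('i%C * 'i%C) * lam * f s by rewrite ii mulN1r.
  by ring.
have fE t : 0 <= t <= 1 -> f t = g 0 * sn lam t.
  move=> t01; rewrite /sn mulrA mulrBr -pE// -qE//.
  rewrite opprD opprK addrACA subrr add0r; by field; exact: i0.
have gE t : 0 <= t <= 1 -> g t = g 0 * cs lam t.
  by move=> t01; rewrite /cs mulrA mulrDr -pE// -qE//; field.
have sn2 := AC_sqintegrable (sn_derivative lam).1.
have cs2 := AC_sqintegrable (cs_derivative lam).1.
exists (g 0).
  rewrite x1E x2E /eigenvectorA; congr pair; rewrite -L2ofZ//;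
    apply/L2of_eqP => //; try exact: sqintegrableZ;
    apply: aeW => t /andP[t0 t1]; [apply: fE|apply: gE]; by rewrite !ltW.
have := fE 1; rewrite f1 ler01 lexx => /(_ isT)/esym/eqP.
rewrite /sn mulrA mulf_eq0 invr_eq0 (negbTE i2) orbF => /eqP.
exact.
Qed.

(** [cos (lam t) + i sin (lam t) = exp (i lam t)] has no zeros. *)
Lemma eigenvectorA_neq0 lam : eigenvectorA lam <> 0.
Proof.
move=> [sn0 cs0].
have sn2 := AC_sqintegrable (sn_derivative lam).1.
have cs2 := AC_sqintegrable (cs_derivative lam).1.
have o2 : sqintegrable (fun _ : R => 1 : R[i]) by exact: AC_sqintegrable (AC_cst 1).
have z2 : sqintegrable (fun _ : R => 0 : R[i]) by exact: AC_sqintegrable (AC_cst 0).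
have : L2of (cexp ('i%C * lam)) = 0.
  rewrite (_ : cexp _ = (fun t => cs lam t + 'i%C * sn lam t)); last first.
    by apply/funext => t; rewrite /cs /sn; field; exact: i0.
  by rewrite L2ofD ?L2ofZ ?sn0 ?cs0 ?scaler0 ?addr0//; exact: sqintegrableZ.
rewrite -(@L2of0 R) => /(L2of_eqP (sqint_cexp _) z2) e0.
have : L2of (fun _ : R => 1 : R[i]) = L2of (fun _ => 0).
  apply/L2of_eqP => //; move: e0; apply: filterS => t /[apply] e0.
  by rewrite -(cexpN ('i%C * lam) t) e0 mul0r.
rewrite L2of0 => /(congr1 (@hnorm _ _)).
by rewrite hnorm0 hnorm_L2of_cst Normc.normc1 => /eqP; rewrite oner_eq0.
Qed.

Lemma eigenvectorAP lam : discriminantA lam = 0 ->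
  opA R (eigenvectorA lam) (lam *: eigenvectorA lam).
Proof.
move=> D0; have ds := sn_derivative lam; have dc := cs_derivative lam.
have sn2 := AC_sqintegrable ds.1; have cs2 := AC_sqintegrable dc.1.
apply/opAE; split=> /=.
  apply/T0_starE; exists (cs lam), (fun t => - lam * sn lam t); split=> //.
    exact: sqintegrableZ.
  by rewrite L2ofZ// scaleNr opprK.
apply/T0E; exists (sn lam), (fun t => lam * cs lam t); split=> //.
- exact: sqintegrableZ.
- by rewrite /sn !cexp0 subrr mul0r -/(discriminantA lam) D0 mul0r.
- by rewrite L2ofZ.
Qed.

(** The constant [c = p 0 = q 0] is determined by the condition [p 1 = q 1]. *)
Lemma decoupled_boundary_problem (m : R[i]) : cexp m 1 - cexp (- m) 1 != 0 ->
  exists M : R, forall h1 h2, sqintegrable h1 -> sqintegrable h2 ->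
  exists p q, [/\ ae_derivative p (fun t => m * p t + h1 t),
    ae_derivative q (fun t => - m * q t + h2 t), p 0 = q 0, p 1 = q 1 &
    forall t, 0 <= t <= 1 ->
      normc (p t) <= M * (hnorm (L2of h1) + hnorm (L2of h2)) /\
      normc (q t) <= M * (hnorm (L2of h1) + hnorm (L2of h2))].
Proof.
move=> D0; set D := _ - _ in D0.
have nD : 0 < normc D.
  by rewrite lt_neqAle normc_ge0 andbT eq_sym; apply: contra D0 => /eqP/Normc.eq0_normc ->.
pose E := expR `|Re m|; pose K := 2 * E ^+ 2.
exists (E * (2 / normc D * K) + K) => h1 h2 h12 h22.
have [V1 [V10 dV1 V1B]] := exists_ode_solution m h12.
have [V2 [V20 dV2 V2B]] := exists_ode_solution (- m) h22.
have ReN : `|Re (- m)| = `|Re m| by case: (m) => a b /=; rewrite normrN.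
rewrite ReN -/E -/K in V2B; rewrite -/E -/K in V1B.
set N := hnorm _ + hnorm _.
have E0 : 0 <= E by exact: expR_ge0.
have K0 : 0 <= K by rewrite mulr_ge0// exprn_ge0.
have {}V1B t : 0 <= t <= 1 -> normc (V1 t) <= K * N.
  by move=> /V1B /le_trans; apply; rewrite ler_wpM2l// lerDl hnorm_ge0.
have {}V2B t : 0 <= t <= 1 -> normc (V2 t) <= K * N.
  by move=> /V2B /le_trans; apply; rewrite ler_wpM2l// lerDr hnorm_ge0.
pose c := (V2 1 - V1 1) / D.
have cB : normc c <= 2 / normc D * K * N.
  rewrite /c Normc.normcM Normc.normcV -[leRHS]mulrA [leRHS]mulrAC.
  rewrite ler_wpM2r ?invr_ge0 ?normc_ge0// mulrDl mul1r.
  apply: le_trans (le_normcD _ _) _.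
  by rewrite normcN lerD//; [apply: V2B|apply: V1B]; rewrite ler01 lexx.
exists (fun t => c * cexp m t + V1 t), (fun t => c * cexp (- m) t + V2 t); split.
- have := ae_derivativeD (ae_derivativeZ c (ae_derivative_cexp m)) dV1.
  by apply: eq_ae_derivative => t; ring.
- have := ae_derivativeD (ae_derivativeZ c (ae_derivative_cexp (- m))) dV2.
  by apply: eq_ae_derivative => t; ring.
- by rewrite V10 V20 !cexp0.
- apply/eqP; rewrite -subr_eq0.
  rewrite (_ : _ - _ = c * D - (V2 1 - V1 1)); last by rewrite /D; ring.
  by rewrite /c divfK// subrr.
move=> t t01; have eB := normc_cexp_le m t01.
have eNB := normc_cexp_le (- m) t01; rewrite ReN in eNB.
by split; apply: le_trans (le_normcD _ _) _; rewrite mulrDl lerD ?V1B ?V2B//;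
  rewrite Normc.normcM mulrC -mulrA ler_pM ?normc_ge0.
Qed.

Let normc_half (u v : R[i]) (Q : R) : normc u <= Q -> normc v <= Q ->
  normc (2^-1 * (u + v)) <= Q.
Proof.
move=> uQ vQ; rewrite Normc.normcM Normc.normcV.
have -> : normc (2 : R[i]) = 2.
  by rewrite -[2 in LHS](rmorph_nat (real_complex R)) normc_real ger0_norm.
rewrite ler_pdivrMl// mulrDl mul1r.
by apply: le_trans (le_normcD _ _) _; exact: lerD.
Qed.

Let normc_i : normc ('i%C : R[i]) = 1.
Proof. by rewrite /= expr0n add0r expr1n sqrtr1. Qed.

Lemma opA_solve lam : discriminantA lam != 0 -> exists M : R, forall y,
  exists2 x, opA R x (y + lam *: x) & hnorm x <= M * hnorm y.
Proof.
move=> D0; have [M HM] := decoupled_boundary_problem D0.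
(* The two decoupled right-hand sides have norm at most [2 |y|] each, and [f], [g]
   are bounded by the same constant. *)
exists (2 * (`|M| * 4)) => -[y1 y2].
have [r r2 y1E] := L2of_repr y1; have [s s2 y2E] := L2of_repr y2.
have is2 := sqintegrableZ 'i%C s2; have nr2 := sqintegrableZ (-1) r2.
have h12 := sqintegrableB is2 r2; have h22 := sqintegrableB nr2 is2.
have [p [q [dp dq pq0 pq1 pqB]]] := HM _ _ h12 h22.
pose f t := (2 * 'i%C)^-1 * (p t - q t); pose g t := 2^-1 * (p t + q t).
have df : ae_derivative f (fun t => s t + lam * g t).
  have := ae_derivativeZ (2 * 'i%C)^-1 (ae_derivativeB dp dq).
  apply: eq_ae_derivative => t; rewrite /g /=; field; exact: i0.
have dg : ae_derivative g (fun t => - (r t + lam * f t)).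
  have := ae_derivativeZ 2^-1 (ae_derivativeD dp dq).
  apply: eq_ae_derivative => t; rewrite /f /=.
  have -> : - (r t + lam * ((2 * 'i%C)^-1 * (p t - q t))) =
      - r t + ('i%C * 'i%C) * lam * ((2 * 'i%C)^-1 * (p t - q t)) by rewrite ii; ring.
  by field; exact: i0.
have f2 := AC_sqintegrable df.1; have g2 := AC_sqintegrable dg.1.
have lf2 := sqintegrableZ lam f2; have lg2 := sqintegrableZ lam g2.
exists (L2of f, L2of g).
  apply/opAE; split=> /=.
    apply/T0_starE; exists g, (fun t => - (r t + lam * f t)); split=> //.
      have := sqintegrableZ (-1) (sqintegrableD r2 lf2).
      by congr sqintegrable; apply/funext => t; rewrite mulN1r.
    rewrite (_ : (fun t => - _) = (fun t => -1 * (r t + lam * f t))); last first.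
      by apply/funext => t; rewrite mulN1r.
    rewrite (@L2ofZ _ (-1) (fun t => r t + lam * f t)); last exact: sqintegrableD.
    by rewrite scaleN1r opprK (L2ofD r2 lf2) (L2ofZ _ f2) -y1E.
  apply/T0E; exists f, (fun t => s t + lam * g t); split=> //.
  - exact: sqintegrableD.
  - by rewrite /f pq0 pq1 !subrr mulr0.
  - by rewrite (L2ofD s2 lg2) (L2ofZ _ g2) -y2E.
have hy1 : hnorm (L2of r) <= hnorm (y1, y2) by rewrite -y1E; exact: (hnorm_fst_le (y1, y2)).
have hy2 : hnorm (L2of s) <= hnorm (y1, y2) by rewrite -y2E; exact: (hnorm_snd_le (y1, y2)).
set ny := hnorm (y1, y2) in hy1 hy2 *.
have B1 : hnorm (L2of (fun t => 'i%C * s t - r t)) <= ny + ny.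
  rewrite L2ofB// L2ofZ//; apply: le_trans (hnormD _ _) _.
  by rewrite hnormN hnormZ normc_i mul1r; exact: lerD hy2 hy1.
have B2 : hnorm (L2of (fun t => -1 * r t - 'i%C * s t)) <= ny + ny.
  rewrite L2ofB// !L2ofZ//; apply: le_trans (hnormD _ _) _.
  by rewrite hnormN !hnormZ normc_i normcN Normc.normc1 !mul1r; exact: lerD hy1 hy2.
set N := hnorm _ + hnorm _ in pqB.
have NB : M * N <= `|M| * 4 * ny.
  have N0 : 0 <= N by rewrite addr_ge0// hnorm_ge0.
  apply: le_trans (ler_wpM2r N0 (ler_norm M)) _; rewrite -mulrA ler_wpM2l//.
  apply: le_trans (lerD B1 B2) _.
  by rewrite (_ : 4 * ny = ny + ny + (ny + ny))//; ring.
have {}pqB t : 0 < t < 1 -> normc (p t) <= `|M| * 4 * ny /\ normc (q t) <= `|M| * 4 * ny.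
  move=> /andP[/ltW t0 /ltW t1]; have [|pt qt] := pqB t; first by rewrite t0.
  by split; [exact: le_trans pt NB|exact: le_trans qt NB].
set Q := `|M| * 4 * ny in pqB.
have Q0 : 0 <= Q by rewrite !mulr_ge0// hnorm_ge0.
have fB : hnorm (L2of f) <= Q.
  rewrite -[leRHS]ger0_norm//; apply: hnorm_L2of_le => // t /pqB[pt qt].
  rewrite /f invfM [_ * 'i%C^-1]mulrC -mulrA Normc.normcM Normc.normcV normc_i invr1 mul1r.
  by apply: normc_half; rewrite ?normcN.
have gB : hnorm (L2of g) <= Q.
  rewrite -[leRHS]ger0_norm//; apply: hnorm_L2of_le => // t /pqB[pt qt].
  exact: normc_half.
apply: le_trans (hnorm_pair_le _) _ => /=.
rewrite -mulrA -/Q mulrDl mul1r; exact: lerD fB gB.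
Qed.

Lemma resolvent_set_opA lam : discriminantA lam != 0 -> resolvent_set (opA R) lam.
Proof.
move=> D0; have oA := self_adjoint_is_operator self_adjoint_opA.
have [M HM] := opA_solve D0.
have uniq x x' y : opA R x (y + lam *: x) -> opA R x' (y + lam *: x') -> x = x'.
  move=> Ax /(is_operatorB oA Ax); rewrite opprD addrACA subrr add0r -scalerBr.
  move=> /opA_eigenvector[c xx' /eqP]; rewrite mulf_eq0 (negbTE D0) orbF => /eqP c0.
  by apply/eqP; rewrite -subr_eq0 xx' c0 scale0r.
split.
  move=> y; have [x Ax _] := HM y; exists x; split; first exact/shiftE.
  by move=> x' /shiftE; exact: uniq.
exists M => x y /shiftE Ax; have [x' Ax' bd] := HM y.
by rewrite (uniq _ _ _ Ax Ax').
Qed.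

Lemma sin_int_pi (k : int) : sin (k%:~R * pi : R) = 0.
Proof.
have nat_case n : sin (n%:R * pi : R) = 0.
  elim: n => [|n IH]; first by rewrite mul0r sin0.
  by rewrite -addn1 natrD mulrDl mul1r sinDpi IH oppr0.
case: k => n; first exact: nat_case.
by rewrite NegzE mulrNz mulNr sinN nat_case oppr0.
Qed.

(** Reduce [a] modulo [pi] to the interval [0, pi[, in whose interior the sine is
    positive. *)
Lemma sin_eq0P (a : R) : sin a = 0 -> exists k : int, a = k%:~R * pi.
Proof.
move=> sa; pose k := Num.floor (a / pi); exists k.
pose b := a - k%:~R * pi.
have pi0 : 0 < pi :> R by exact: pi_gt0.
have b0 : 0 <= b by rewrite subr_ge0 -ler_pdivlMr// ge_floor.
have bpi : b < pi.
  rewrite ltrBlDl -[X in _ + X]mul1r -mulrDl -ltr_pdivrMr// -(intrD _ k 1).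
  exact: floorD1_gt.
have sb : sin b = 0 by rewrite sinB sa sin_int_pi mul0r mulr0 subrr.
have : b = 0.
  apply/eqP; rewrite eq_le b0 andbT leNgt; apply/negP => b_gt0.
  by have := sin_gt0_pi (x := b); rewrite b_gt0 bpi sb ltxx => /(_ isT).
by move=> /eqP; rewrite subr_eq0 => /eqP.
Qed.

(** For [lam = a + i b] the equation splits into [(exp (- b) - exp b) cos a = 0] and
    [(exp (- b) + exp b) sin a = 0]. *)
Lemma discriminantA_eq0 lam : discriminantA lam = 0 <->
  exists k : int, lam = (k%:~R * pi)%:C.
Proof.
rewrite /discriminantA; case: lam => a b; rewrite /cexp.
rewrite (_ : 'i%C * _ = - b +i* a); last by simpc.
rewrite /= !mulr1 opprK cosN sinN; split.
  move=> [cE sE].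
  have eb0 : 0 < expR b + expR (- b) by rewrite addr_gt0 ?expR_gt0.
  have /eqP : (expR b + expR (- b)) * sin a = 0 by rewrite -sE; ring.
  rewrite mulf_eq0 gt_eqF//= => /eqP sa.
  have ca : cos a != 0.
    apply/eqP => ca; have := cos2Dsin2 a; rewrite ca sa expr0n addr0.
    by move/esym/eqP; rewrite oner_eq0.
  have /eqP : (expR (- b) - expR b) * cos a = 0 by rewrite -cE; ring.
  rewrite mulf_eq0 (negbTE ca) orbF subr_eq0 => /eqP/expR_inj bE.
  have b0 : b = 0 by lra.
  by have [k ->] := sin_eq0P sa; exists k; rewrite b0.
move=> [k [-> ->]].
by rewrite oppr0 sin_int_pi oppr0 mulr0 !subrr.
Qed.

End SpectrumOfA.

(** * The operator H *)

Theorem proposition4p1 (R : realType) :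
  let A := opA R in
  let B := op_add A (op_scalar 1) in
  let C := op_scalar 0 in
  let D := op_opp A in
  let H := block_op A B C D in
  [/\ adjoint (T0 R) = T0_star R,
      symplectic_self_adjoint A B C D,
      spectrum H = point_spectrum H,
      point_spectrum H = [set lam | exists k : int, lam = (k%:~R * pi)%:C]
    & forall lam, spectrum H lam -> finite_algebraic_multiplicity H lam].
Proof.
move=> A B C D H; have sA : self_adjoint A := self_adjoint_opA.
pose S : set R[i] := [set lam | exists k : int, lam = (k%:~R * pi)%:C].
have SN lam : S (- lam) -> S lam.
  move=> [k lamE]; exists (- k).
  by rewrite -[lam]opprK lamE -rmorphN mulrNz mulNr.
have Sdisc lam : discriminantA lam = 0 <-> S lam by exact: discriminantA_eq0.
have S_point : S `<=` point_spectrum H.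
  move=> lam /Sdisc/eigenvectorAP Aphi; apply: point_spectrum_block_hamiltonian => //.
  by exists (eigenvectorA lam) => //; exact: eigenvectorA_neq0.
have point_spec : point_spectrum H `<=` spectrum H.
  exact: point_spectrum_sub_spectrum (block_hamiltonian0 sA).
have spec_S : spectrum H `<=` S.
  move=> lam Hlam; apply: contrapT => Slam; apply: Hlam.
  by apply: resolvent_set_block_hamiltonian => //; apply: resolvent_set_opA;
    apply/eqP => /Sdisc// /SN.
split.
- exact: adjoint_T0.
- exact: symplectic_self_adjoint_block.
- by apply/seteqP; split=> // lam /spec_S/S_point.
- by apply/seteqP; split=> // lam /point_spec/spec_S.
move=> lam /spec_S[k lamE].
apply: (@finite_algebraic_multiplicity_block_hamiltonian _ _ _ _ _
  (eigenvectorA lam) (eigenvectorA (- lam))) => //.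
- by rewrite lamE /= oppr0.
- by move=> x /opA_eigenvector[c]; exists c.
- by move=> x /opA_eigenvector[c]; exists c.
Qed.
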